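(* Let $A$ be a commutative ring and $I$ a finitely generated ideal of $A$. Put $X:=\operatorname{Spec}(A)$ and $Y:=V(I)\subset X$. Assume that there exists $n$ such that $$H^i_I(A)=H^i_Y(X,\mathcal{O}_X)=0\quad\text{for } i\neq n.$$ Then, for any bounded below complex $K^\bullet$ of projective $A$-modules of finite type (respectively, for any complex $K^\bullet$ of projective $A$-modules of finite type, if $A$ is Noetherian of finite dimension), there exists a spectral sequence $$E_2^{p,q}=H^p_I\big(H^q(\operatorname{Hom}_A^\bullet(K^\bullet,A))\big)\ \Rightarrow\ H^{p+q-n}\big(\operatorname{Hom}_A^\bullet(K^\bullet,H^n_I(A))\big).$$
   Context: For a finitely generated ideal $I=(a_1,\dots,a_r)$ and an $A$-module $N$, $H^i_I(N)$ denotes the $i$-th cohomology module of the Čech complex of $N$ on $a_1,\dots,a_r$; it is isomorphic to the sheaf cohomology with support $H^i_Y(X,\widetilde{N})$, in particular $H^i_I(A)\simeq H^i_Y(X,\mathcal{O}_X)$ with $\mathcal{O}_X=\widetilde{A}$. For a cochain complex $K^\bullet$ and an $A$-module $N$, $\operatorname{Hom}_A^\bullet(K^\bullet,N)$ is the usual Hom complex, with degree $q$ component $\operatorname{Hom}_A(K^{-q},N)$, and $H^q(\cdot)$ is its $q$-th cohomology module. ''Finite type'' means finitely generated. *)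

(* Defs.v *)
From HB Require Import structures.
From mathcomp Require Import all_boot all_order all_algebra.
From mathcomp Require Import boolp zify ring.

Set Implicit Arguments.
Unset Strict Implicit.
Unset Printing Implicit Defensive.

Import Order.TTheory GRing.Theory Num.Theory.
Local Open Scope ring_scope.
Local Open Scope quotient_scope.

Record submodule (A : comPzRingType) (M : lmodType A) := Submodule {
  submod_pred :> {pred M};
  submodP : submod_closed submod_pred
}.

HB.instance Definition _ (A : comPzRingType) (M : lmodType A) (S : submodule M) :=
  GRing.isSubmodClosed.Build A M (submod_pred S) (submodP S).

Definition lin_iso (A : pzRingType) (M N : lmodType A) : Prop :=
  exists f : {linear M -> N}, bijective f.

Notation "M ≃ N" := (lin_iso M N) (at level 70, no associativity).

Definition is_zero (A : pzRingType) (M : lmodType A) : Prop :=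
  forall x : M, x = 0.

Section KernelImage.
Variables (A : comPzRingType) (M N : lmodType A) (f : {linear M -> N}).

Fact ker_closed : submod_closed (fun x : M => f x == 0).
Proof.
split=> [|a x y]; first by rewrite unfold_in linear0.
by rewrite !unfold_in linearP => /eqP-> /eqP->; rewrite scaler0 addr0.
Qed.

Fact im_closed : submod_closed (fun y : N => `[< exists x, f x = y >]).
Proof.
split=> [|a x y]; first by apply/asboolP; exists 0; rewrite linear0.
move=> /asboolP[u <-] /asboolP[v <-]; apply/asboolP.
by exists (a *: u + v); rewrite linearP.
Qed.

Definition ker : submodule M := Submodule ker_closed.
Definition im : submodule N := Submodule im_closed.

End KernelImage.

Section Subquotient.
Variables (A : comPzRingType) (M : lmodType A).

Section Sub.
Variable S : submodule M.

Definition submod : Type := {x : M | x \in S}.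

HB.instance Definition _ := [isSub of submod for @sval M (fun x => x \in S)].
HB.instance Definition _ := [Choice of submod by <:].
HB.instance Definition _ := [SubChoice_isSubLmodule of submod by <:].

End Sub.

Section Quotient.
Variable S : submodule M.

Definition quomod : Type := Quotient.quot S.

HB.instance Definition _ := GRing.Zmodule.on quomod.

Definition quomod_class (x : M) : quomod := \pi_(Quotient.quot S) x.

Definition quomod_scale (a : A) (x : quomod) : quomod :=
  quomod_class (a *: repr (x : Quotient.quot S)).

Fact quomod_classE (x y : M) :
  (quomod_class x == quomod_class y) = (x - y \in S).
Proof. by rewrite /quomod_class -Quotient.idealrBE. Qed.

Fact quomod_classP (x : quomod) : exists y, x = quomod_class y.
Proof. by exists (repr (x : Quotient.quot S)); rewrite /quomod_class reprK. Qed.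

Fact quomod_class_is_zmod_morphism : zmod_morphism quomod_class.
Proof. by move=> x y; rewrite /quomod_class raddfB. Qed.

HB.instance Definition _ := GRing.isZmodMorphism.Build M quomod quomod_class
  quomod_class_is_zmod_morphism.

Fact quomod_scaleE a x :
  quomod_scale a (quomod_class x) = quomod_class (a *: x).
Proof.
apply/eqP; rewrite quomod_classE -scalerBr rpredZ //.
by rewrite -quomod_classE /quomod_class reprK.
Qed.

Fact quomod_scaleA a b x :
  quomod_scale a (quomod_scale b x) = quomod_scale (a * b) x.
Proof.
by have [y ->] := quomod_classP x; rewrite !quomod_scaleE scalerA.
Qed.

Fact quomod_scale1 : left_id 1 quomod_scale.
Proof.
by move=> x; have [y ->] := quomod_classP x; rewrite quomod_scaleE scale1r.
Qed.

Fact quomod_scaleDr : right_distributive quomod_scale +%R.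
Proof.
move=> a x x'; have [y ->] := quomod_classP x; have [y' ->] := quomod_classP x'.
by rewrite -raddfD !quomod_scaleE -raddfD scalerDr.
Qed.

Fact quomod_scaleDl x : {morph quomod_scale^~ x : a b / a + b}.
Proof.
move=> a b; have [y ->] := quomod_classP x.
by rewrite !quomod_scaleE -raddfD scalerDl.
Qed.

HB.instance Definition _ := GRing.Zmodule_isLmodule.Build A quomod
  quomod_scaleA quomod_scale1 quomod_scaleDr quomod_scaleDl.

Fact quomod_class_is_scalable : scalable quomod_class.
Proof. by move=> a x; rewrite -quomod_scaleE. Qed.

HB.instance Definition _ := GRing.isScalable.Build A M quomod *:%R quomod_class
  quomod_class_is_scalable.

End Quotient.
End Subquotient.

Section SubquotientOf.
Variables (A : comPzRingType) (M : lmodType A) (Z B : submodule M).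

Fact submod_trace_closed : submod_closed (fun x : submod Z => val x \in B).
Proof.
have [B0 BD] := submodP B.
split=> [|a x y Bx By]; first by rewrite unfold_in linear0.
by rewrite unfold_in linearP; exact: BD.
Qed.

Definition submod_trace : submodule (submod Z) := Submodule submod_trace_closed.

(* Z / (Z ∩ B); all uses below have B contained in Z *)
Definition subquo : lmodType A := quomod submod_trace.

End SubquotientOf.

Definition homology (A : comPzRingType) (L M N : lmodType A)
    (f : {linear L -> M}) (g : {linear M -> N}) : lmodType A :=
  subquo (ker g) (im f).

(* The differential is indexed by both source and target, which avoids
   transports along (i - 1) + 1 = i; only its components from degree i to
   degree i + 1 may be nonzero. *)
Record cochain_complex (A : comPzRingType) := CochainComplex {
  cobj :> int -> lmodType A;
  codiff : forall i j, {linear cobj i -> cobj j};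
  codiff_shape : forall i j, j != i + 1 -> forall x, codiff i j x = 0;
  codiff_comp : forall i j k x, codiff j k (codiff i j x) = 0
}.

Definition cohomology (A : comPzRingType) (K : cochain_complex A) (i : int) :
    lmodType A :=
  homology (codiff K (i - 1) i) (codiff K i (i + 1)).

Section Hom.
Variables (A : comPzRingType) (M N : lmodType A).

Definition Hom : Type := {linear M -> N}.

HB.instance Definition _ := gen_eqMixin Hom.
HB.instance Definition _ := gen_choiceMixin Hom.

Definition hom_fun (f : Hom) : M -> N := (f : {linear M -> N}).

Fact hom_ext (f g : Hom) : hom_fun f =1 hom_fun g -> f = g.
Proof.
case: f => f cf; case: g => g cg /funext /= e; subst g.
congr GRing.Linear.Pack.
case: cf => [[a] [b]]; case: cg => [[a'] [b']].
by rewrite (Prop_irrelevance a a') (Prop_irrelevance b b').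
Qed.

Definition hom_zero : Hom := (\0 : M -> N).
Definition hom_opp (f : Hom) : Hom := (\- f : M -> N).
Definition hom_add (f g : Hom) : Hom := (f \+ g : M -> N).
Definition hom_scale (a : A) (f : Hom) : Hom := (a \*: f : M -> N).

Fact hom_addA : associative hom_add.
Proof. by move=> f g h; apply: hom_ext => x; exact: addrA. Qed.
Fact hom_addC : commutative hom_add.
Proof. by move=> f g; apply: hom_ext => x; exact: addrC. Qed.
Fact hom_add0 : left_id hom_zero hom_add.
Proof. by move=> f; apply: hom_ext => x; exact: add0r. Qed.
Fact hom_addN : left_inverse hom_zero hom_opp hom_add.
Proof. by move=> f; apply: hom_ext => x; exact: addNr. Qed.

HB.instance Definition _ :=
  GRing.isZmodule.Build Hom hom_addA hom_addC hom_add0 hom_addN.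

Fact hom_scaleA a b f : hom_scale a (hom_scale b f) = hom_scale (a * b) f.
Proof. by apply: hom_ext => x; exact: scalerA. Qed.
Fact hom_scale1 : left_id 1 hom_scale.
Proof. by move=> f; apply: hom_ext => x; exact: scale1r. Qed.
Fact hom_scaleDr : right_distributive hom_scale +%R.
Proof. by move=> a f g; apply: hom_ext => x; exact: scalerDr. Qed.
Fact hom_scaleDl f : {morph hom_scale^~ f : a b / a + b}.
Proof. by move=> a b; apply: hom_ext => x; exact: scalerDl. Qed.

HB.instance Definition _ := GRing.Zmodule_isLmodule.Build A Hom
  hom_scaleA hom_scale1 hom_scaleDr hom_scaleDl.

End Hom.

Section HomComplex.
Variables (A : comPzRingType) (K : cochain_complex A) (N : lmodType A).

(* Sign convention: N is the complex concentrated in degree 0, and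
   d(f) = d_N f - (-1)^q f d_K in degree q. *)
Definition hom_diff (q q' : int) (f : Hom (K (- q)) N) : Hom (K (- q')) N :=
  hom_scale ((-1) ^+ `|q|.+1) (hom_fun f \o codiff K (- q') (- q)).

Fact hom_diff_linear q q' : linear (@hom_diff q q').
Proof.
move=> a f g; apply: hom_ext => x /=.
rewrite /hom_fun /= /hom_fun /=.
by rewrite [LHS]scalerDr !scalerA mulrC.
Qed.

HB.instance Definition _ q q' := GRing.isLinear.Build A
  (Hom (K (- q)) N) (Hom (K (- q')) N) *:%R (@hom_diff q q')
  (@hom_diff_linear q q').

Fact hom_diff_shape q q' : q' != q + 1 -> forall f, @hom_diff q q' f = 0.
Proof.
move=> qq' f; apply: hom_ext => x; rewrite /hom_fun /=.
rewrite codiff_shape ?linear0 ?scaler0 //.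
by apply: contra qq' => /eqP e; apply/eqP; rewrite -[q]opprK e opprD opprK subrK.
Qed.

Fact hom_diff_comp q q' q'' f : @hom_diff q' q'' (@hom_diff q q' f) = 0.
Proof.
apply: hom_ext => x; rewrite /hom_fun /= /hom_fun /=.
by rewrite codiff_comp linear0 !scaler0.
Qed.

Definition hom_complex : cochain_complex A :=
  CochainComplex hom_diff_shape hom_diff_comp.

End HomComplex.

Section Localization.
Variables (A : comPzRingType) (N : lmodType A) (f : A).
Implicit Types (m : N) (k : nat).

(* (m, k) stands for the fraction m / f^k *)
Definition loc_rel (x y : N * nat) : bool :=
  `[< exists l, f ^+ (l + y.2) *: x.1 = f ^+ (l + x.2) *: y.1 >].

Fact loc_rel_is_equiv : equiv_class_of loc_rel.
Proof.
split=> [x|x y|y x z].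
- by apply/asboolP; exists 0.
- by apply/asboolP/asboolP => -[l e]; exists l; rewrite e.
- move=> /asboolP[l e] /asboolP[l' e']; apply/asboolP.
  exists (l + l' + y.2)%N.
  have -> : (l + l' + y.2 + z.2 = (l' + z.2) + (l + y.2))%N by lia.
  have -> : (l + l' + y.2 + x.2 = (l + x.2) + (l' + y.2))%N by lia.
  by rewrite exprD -scalerA e scalerA mulrC -scalerA e' scalerA -exprD.
Qed.

Canonical loc_equiv := EquivRelPack loc_rel_is_equiv.
Canonical loc_encModRel := defaultEncModRel loc_rel.

Definition loc : Type := {eq_quot loc_rel}.

HB.instance Definition _ := Choice.on loc.

Definition loc_frac m k : loc := \pi_({eq_quot loc_rel}) (m, k).

Fact loc_fracP (x : loc) : exists m k, x = loc_frac m k.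
Proof.
exists (repr (x : {eq_quot loc_rel})).1, (repr (x : {eq_quot loc_rel})).2.
by rewrite /loc_frac -surjective_pairing reprK.
Qed.

Fact loc_frac_eq m k m' k' : loc_frac m k = loc_frac m' k' <->
  exists l, f ^+ (l + k') *: m = f ^+ (l + k) *: m'.
Proof.
split=> [/eqP|e]; rewrite /loc_frac ?eqmodE; first by move/asboolP.
by apply/eqP; rewrite eqmodE; apply/asboolP.
Qed.

Fact loc_frac_expand j m k : loc_frac m k = loc_frac (f ^+ j *: m) (k + j).
Proof.
by apply/loc_frac_eq; exists 0%N; rewrite scalerA -exprD add0n.
Qed.

Definition loc_num (x : loc) : N := (repr (x : {eq_quot loc_rel})).1.
Definition loc_exp (x : loc) : nat := (repr (x : {eq_quot loc_rel})).2.

Fact loc_numK (x : loc) : loc_frac (loc_num x) (loc_exp x) = x.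
Proof. by rewrite /loc_frac -surjective_pairing reprK. Qed.

Definition loc_add (x y : loc) : loc :=
  loc_frac (f ^+ loc_exp y *: loc_num x + f ^+ loc_exp x *: loc_num y)
    (loc_exp x + loc_exp y).
Definition loc_opp (x : loc) : loc := loc_frac (- loc_num x) (loc_exp x).
Definition loc_scale (a : A) (x : loc) : loc :=
  loc_frac (a *: loc_num x) (loc_exp x).

Fact loc_scaleE a m k : loc_scale a (loc_frac m k) = loc_frac (a *: m) k.
Proof.
have /loc_frac_eq[l e] := loc_numK (loc_frac m k).
apply/loc_frac_eq; exists l.
by rewrite scalerA mulrC -scalerA e scalerA mulrC -scalerA.
Qed.

Fact loc_oppE m k : loc_opp (loc_frac m k) = loc_frac (- m) k.
Proof.
have /loc_frac_eq[l e] := loc_numK (loc_frac m k).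
by apply/loc_frac_eq; exists l; rewrite !scalerN e.
Qed.

Fact loc_addE m m' k :
  loc_add (loc_frac m k) (loc_frac m' k) = loc_frac (m + m') k.
Proof.
rewrite /loc_add.
have /loc_frac_eq[l e] := loc_numK (loc_frac m k).
have /loc_frac_eq[l' e'] := loc_numK (loc_frac m' k).
move: e e'; set u := loc_num (loc_frac m k); set i := loc_exp (loc_frac m k).
set v := loc_num (loc_frac m' k); set j := loc_exp (loc_frac m' k) => e e'.
apply/loc_frac_eq; exists (l + l')%N; rewrite !scalerDr !scalerA -!exprD.
have -> : (l + l' + k + j = (l' + j) + (l + k))%N by lia.
have -> : (l + l' + k + i = (l + i) + (l' + k))%N by lia.
rewrite [f ^+ (l' + j + _)]exprD [f ^+ (l + i + _)]exprD -!scalerA e e'.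
by rewrite !scalerA -!exprD; congr (f ^+ _ *: _ + f ^+ _ *: _); lia.
Qed.

Fact loc_common (x y z : loc) : exists k m m' m'',
  [/\ x = loc_frac m k, y = loc_frac m' k & z = loc_frac m'' k].
Proof.
have [[m [i ->]] [m' [j ->]] [m'' [k ->]]] :=
  And3 (loc_fracP x) (loc_fracP y) (loc_fracP z).
exists (i + j + k)%N, (f ^+ (j + k) *: m), (f ^+ (i + k) *: m'),
  (f ^+ (i + j) *: m''); split.
- by rewrite (loc_frac_expand (j + k)%N) addnA.
- by rewrite (loc_frac_expand (i + k)%N) addnCA -addnA.
- by rewrite (loc_frac_expand (i + j)%N) [(k + _)%N]addnC.
Qed.

Definition loc_zero : loc := loc_frac 0 0.

Fact loc_zeroE k : loc_frac 0 k = loc_zero.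
Proof. by apply/loc_frac_eq; exists 0%N; rewrite !scaler0. Qed.

Fact loc_addA : associative loc_add.
Proof.
move=> x y z; have [k [m [m' [m'' [-> -> ->]]]]] := loc_common x y z.
by rewrite !loc_addE addrA.
Qed.
Fact loc_addC : commutative loc_add.
Proof.
move=> x y; have [k [m [m' [_ [-> -> _]]]]] := loc_common x y y.
by rewrite !loc_addE addrC.
Qed.
Fact loc_add0 : left_id loc_zero loc_add.
Proof.
move=> x; have [m [k ->]] := loc_fracP x.
by rewrite -(loc_zeroE k) loc_addE add0r.
Qed.
Fact loc_addN : left_inverse loc_zero loc_opp loc_add.
Proof.
move=> x; have [m [k ->]] := loc_fracP x.
by rewrite loc_oppE loc_addE addNr loc_zeroE.
Qed.

HB.instance Definition _ :=
  GRing.isZmodule.Build loc loc_addA loc_addC loc_add0 loc_addN.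

Fact loc_fracD k m m' : loc_frac (m + m') k = loc_frac m k + loc_frac m' k.
Proof. by rewrite -loc_addE. Qed.

Fact loc_scaleA a b x : loc_scale a (loc_scale b x) = loc_scale (a * b) x.
Proof.
by have [m [k ->]] := loc_fracP x; rewrite !loc_scaleE scalerA.
Qed.
Fact loc_scale1 : left_id 1 loc_scale.
Proof.
by move=> x; have [m [k ->]] := loc_fracP x; rewrite loc_scaleE scale1r.
Qed.
Fact loc_scaleDr : right_distributive loc_scale +%R.
Proof.
move=> a x y; have [k [m [m' [_ [-> -> _]]]]] := loc_common x y y.
by rewrite -loc_fracD !loc_scaleE -loc_fracD scalerDr.
Qed.
Fact loc_scaleDl x : {morph loc_scale^~ x : a b / a + b}.
Proof.
move=> a b; have [m [k ->]] := loc_fracP x.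
by rewrite !loc_scaleE -loc_fracD scalerDl.
Qed.

HB.instance Definition _ := GRing.Zmodule_isLmodule.Build A loc
  loc_scaleA loc_scale1 loc_scaleDr loc_scaleDl.

Fact loc_fracZ k a m : loc_frac (a *: m) k = a *: loc_frac m k.
Proof. by rewrite -loc_scaleE. Qed.

End Localization.

Section LocMap.
Variables (A : comPzRingType) (N : lmodType A).

(* The canonical map N_f -> N_f', m / f^k |-> (b^k m) / f'^k, where f' = b f;
   it is independent of the representing fraction under this condition only. *)
Definition loc_map (b f f' : A) (x : loc N f) : loc N f' :=
  loc_frac f' (b ^+ loc_exp x *: loc_num x) (loc_exp x).

Fact loc_mapE b f f' (e : f' = b * f) m k :
  loc_map b f' (loc_frac f m k) = loc_frac f' (b ^+ k *: m) k.
Proof.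
rewrite /loc_map; have /loc_frac_eq[l] := loc_numK (loc_frac f m k).
move: (loc_num _) (loc_exp _) => u i eu.
apply/loc_frac_eq; exists l; rewrite e !exprMn !scalerA.
have -> : b ^+ (l + k) * f ^+ (l + k) * b ^+ i = b ^+ (l + k + i) * f ^+ (l + k).
  by rewrite mulrAC -exprD.
have -> : b ^+ (l + i) * f ^+ (l + i) * b ^+ k = b ^+ (l + k + i) * f ^+ (l + i).
  by rewrite mulrAC -exprD addnAC.
by rewrite -!scalerA eu.
Qed.

Fact loc_map_linear b f f' (e : f' = b * f) : linear (@loc_map b f f').
Proof.
move=> a x y; have [k [m [m' [_ [-> -> _]]]]] := loc_common x y y.
rewrite -loc_fracZ -loc_fracD !loc_mapE //.
by rewrite -loc_fracZ -loc_fracD scalerDr !scalerA mulrC.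
Qed.

Fact loc_map0 b f f' (e : f' = b * f) : loc_map b f' (0 : loc N f) = 0.
Proof. by rewrite loc_mapE // scaler0 loc_zeroE. Qed.

Fact loc_mapZ b f f' (e : f' = b * f) c (x : loc N f) :
  loc_map b f' (c *: x) = c *: loc_map b f' x.
Proof. by rewrite -[c *: x]addr0 loc_map_linear // loc_map0 // addr0. Qed.

Fact loc_map_sum b f f' (e : f' = b * f) (J : finType) (P : {pred J})
    (x : J -> loc N f) :
  loc_map b f' (\sum_(j in P) x j) = \sum_(j in P) loc_map b f' (x j).
Proof.
apply: (big_morph (loc_map b f')) => [u v|]; last exact: loc_map0.
by rewrite -[u]scale1r loc_map_linear // !scale1r.
Qed.

Fact loc_map_comp b b' f f' f'' (e : f' = b * f) (e' : f'' = b' * f') x :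
  loc_map b' f'' (loc_map b f' x) = loc_map (b' * b) f'' (x : loc N f).
Proof.
have [m [k ->]] := loc_fracP x; rewrite !loc_mapE ?e' ?e ?mulrA //.
by rewrite scalerA exprMn.
Qed.

End LocMap.

Section Product.
Variables (A : comPzRingType) (T : Type) (F : T -> lmodType A).

Definition prodmod : Type := forall t, F t.

HB.instance Definition _ := Choice.on prodmod.

Definition prodmod_zero : prodmod := fun t => 0.
Definition prodmod_opp (x : prodmod) : prodmod := fun t => - x t.
Definition prodmod_add (x y : prodmod) : prodmod := fun t => x t + y t.
Definition prodmod_scale (a : A) (x : prodmod) : prodmod := fun t => a *: x t.

Fact prodmod_addA : associative prodmod_add.
Proof. by move=> x y z; apply: functional_extensionality_dep => t; exact: addrA. Qed.
Fact prodmod_addC : commutative prodmod_add.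
Proof. by move=> x y; apply: functional_extensionality_dep => t; exact: addrC. Qed.
Fact prodmod_add0 : left_id prodmod_zero prodmod_add.
Proof. by move=> x; apply: functional_extensionality_dep => t; exact: add0r. Qed.
Fact prodmod_addN : left_inverse prodmod_zero prodmod_opp prodmod_add.
Proof. by move=> x; apply: functional_extensionality_dep => t; exact: addNr. Qed.

HB.instance Definition _ := GRing.isZmodule.Build prodmod
  prodmod_addA prodmod_addC prodmod_add0 prodmod_addN.

Fact prodmod_scaleA a b x :
  prodmod_scale a (prodmod_scale b x) = prodmod_scale (a * b) x.
Proof. by apply: functional_extensionality_dep => t; exact: scalerA. Qed.
Fact prodmod_scale1 : left_id 1 prodmod_scale.
Proof. by move=> x; apply: functional_extensionality_dep => t; exact: scale1r. Qed.
Fact prodmod_scaleDr : right_distributive prodmod_scale +%R.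
Proof. by move=> a x y; apply: functional_extensionality_dep => t; exact: scalerDr. Qed.
Fact prodmod_scaleDl x : {morph prodmod_scale^~ x : a b / a + b}.
Proof. by move=> a b; apply: functional_extensionality_dep => t; exact: scalerDl. Qed.

HB.instance Definition _ := GRing.Zmodule_isLmodule.Build A prodmod
  prodmod_scaleA prodmod_scale1 prodmod_scaleDr prodmod_scaleDl.

Fact prodmod_addE (x y : prodmod) t : (x + y) t = x t + y t.
Proof. by []. Qed.
Fact prodmod_scaleE a (x : prodmod) t : (a *: x) t = a *: x t.
Proof. by []. Qed.
Fact prodmod_zeroE t : (0 : prodmod) t = 0.
Proof. by []. Qed.

End Product.

Section Cech.
Variables (A : comPzRingType) (r : nat) (a : 'I_r -> A) (N : lmodType A).

Definition cech_den (S : {set 'I_r}) : A := \prod_(i in S) a i.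

Definition cech_index (p : int) : Type := {S : {set 'I_r} | #|S|%:Z == p}.

Definition cech_face p (S : {set 'I_r}) (h : #|S|%:Z = p) : cech_index p :=
  exist _ S (introT eqP h).

(* The product over i_1 < ... < i_p of the localizations of N at
   a_{i_1} ... a_{i_p}; the term of degree 0 is N_1 = N. *)
Definition cech_obj (p : int) : lmodType A :=
  prodmod (fun S : cech_index p => loc N (cech_den (val S)) : lmodType A).

(* The component of x at an arbitrary subset, 0 if its cardinal is not p. *)
Definition cech_comp p (x : cech_obj p) (S : {set 'I_r}) : loc N (cech_den S) :=
  if #|S|%:Z =P p is ReflectT h then x (cech_face h) else 0.

Definition cech_sign (S : {set 'I_r}) (i : 'I_r) : A :=
  (-1) ^+ #|[set j in S | (j < i)%N]|.

Definition cech_diff p p' (x : cech_obj p) : cech_obj p' := fun S =>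
  \sum_(i in val S) cech_sign (val S) i *:
    loc_map (a i) (cech_den (val S)) (cech_comp x (val S :\ i)).

Fact cech_denD1 (S : {set 'I_r}) i : i \in S ->
  cech_den S = a i * cech_den (S :\ i).
Proof. by move=> iS; rewrite /cech_den (big_setD1 i iS). Qed.

Fact cech_signD1 (S : {set 'I_r}) i j : i \in S ->
  cech_sign S j = (-1) ^+ (i < j)%N * cech_sign (S :\ i) j.
Proof.
move=> iS; rewrite /cech_sign -exprD; congr (_ ^+ _).
rewrite (cardsD1 i) inE iS /=; congr (_ + _)%N.
by apply: eq_card => k; rewrite !inE andbA.
Qed.

Fact cech_comp_val p (x : cech_obj p) (S : cech_index p) :
  cech_comp x (val S) = x S.
Proof.
case: S => S h; rewrite /cech_comp /=.
case: eqP => [h'|/eqP]; last by rewrite h.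
by rewrite /cech_face (bool_irrelevance (introT eqP h') h).
Qed.

Fact cech_comp_out p (x : cech_obj p) (S : {set 'I_r}) :
  #|S|%:Z != p -> cech_comp x S = 0.
Proof. by rewrite /cech_comp; case: eqP. Qed.

Fact cech_comp_linear p (S : {set 'I_r}) :
  linear (fun x : cech_obj p => cech_comp x S).
Proof.
by move=> c x y; rewrite /cech_comp; case: eqP => // _; rewrite scaler0 addr0.
Qed.

Fact cech_diff_linear p p' : linear (@cech_diff p p').
Proof.
move=> c x y; apply: functional_extensionality_dep => S.
rewrite prodmod_addE prodmod_scaleE /cech_diff scaler_sumr -big_split.
apply: eq_bigr => i iS /=.
rewrite cech_comp_linear (loc_map_linear (cech_denD1 iS)).
by rewrite scalerDr !scalerA mulrC.
Qed.

HB.instance Definition _ p p' := GRing.isLinear.Build A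
  (cech_obj p) (cech_obj p') *:%R (@cech_diff p p') (@cech_diff_linear p p').

Fact cech_diff_shape p p' :
  p' != p + 1 -> forall x, @cech_diff p p' x = 0.
Proof.
move=> pp' x; apply: functional_extensionality_dep => S.
rewrite /cech_diff big1 // => i iS.
rewrite cech_comp_out.
  by rewrite (loc_map0 _ (cech_denD1 iS)) scaler0.
apply: contra pp' => /eqP <-; case: S iS => S /= /eqP <- iS.
by rewrite (cardsD1 i S) iS addrC.
Qed.

Fact cech_diff_comp p p' p'' x : @cech_diff p' p'' (@cech_diff p p' x) = 0.
Proof.
have [pp'|pp'] := eqVneq p' (p + 1); last first.
  by rewrite (cech_diff_shape pp') linear0.
apply: functional_extensionality_dep => S; rewrite prodmod_zeroE /cech_diff.
have [SS|SS] := eqVneq (#|val S|%:Z) (p' + 1); last first.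
  rewrite big1 // => i iS; rewrite cech_comp_out.
    by rewrite (loc_map0 _ (cech_denD1 iS)) scaler0.
  by apply: contra SS; rewrite (cardsD1 i (val S)) iS => /eqP<-; rewrite addrC.
set D := val S in SS *.
pose G i j := cech_sign D i * cech_sign (D :\ i) j *:
  loc_map (a i * a j) (cech_den D) (cech_comp x (D :\ i :\ j)).
transitivity (\sum_(i in D) \sum_(j in D :\ i) G i j).
  apply: eq_bigr => i iD.
  have h : #|D :\ i|%:Z = p'.
    by apply: (addrI 1); rewrite [RHS]addrC -SS (cardsD1 i D) iD.
  rewrite -[D :\ i]/(val (cech_face h)) cech_comp_val.
  have /= eD := cech_denD1 iD.
  rewrite loc_map_sum // scaler_sumr; apply: eq_bigr => j jD.
  rewrite loc_mapZ // scalerA; congr (_ *: _).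
  by rewrite (loc_map_comp (cech_denD1 jD) eD).
have Gopp i j : i \in D -> j \in D -> (j < i)%N -> G i j + G j i = 0.
  move=> iD jD ji; have ij : (i < j)%N = false by rewrite ltnNge ltnW.
  rewrite /G setDDl setUC -setDDl [a j * _]mulrC -scalerDl.
  have -> : cech_sign (D :\ i) j = cech_sign D j.
    by rewrite (cech_signD1 j iD) ij mul1r.
  have -> : cech_sign (D :\ j) i = - cech_sign D i.
    by rewrite (cech_signD1 i jD) ji mulN1r opprK.
  by rewrite mulrN [cech_sign D j * _]mulrC addrN scale0r.
rewrite (eq_bigr (fun i : 'I_r => \sum_(j in D | (j < i)%N) G i j +
                           \sum_(j in D | (i < j)%N) G i j)); last first.
  move=> i iD; rewrite (bigID (fun j : 'I_r => (j < i)%N)) /=.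
  congr (_ + _); apply: eq_bigl => j; rewrite in_setD1 -val_eqE /=;
    by case: (j \in D); case: ltngtP.
rewrite big_split /= [X in _ + X](exchange_big_dep (mem D)) /=; last first.
  by move=> i j _ /andP[].
rewrite -big_split big1 // => i iD /=; rewrite iD /= -big_split big1 //=.
by move=> j /andP[jD ji]; exact: Gopp.
Qed.

Definition cech_complex : cochain_complex A :=
  CochainComplex cech_diff_shape cech_diff_comp.

(* H^i_I(N) for I = (a_1, ..., a_r), computed on these generators *)
Definition local_cohomology (i : int) : lmodType A := cohomology cech_complex i.

End Cech.

Definition finite_type (A : comPzRingType) (M : lmodType A) : Prop :=
  exists (k : nat) (g : 'I_k -> M), forall x : M,
    exists c : 'I_k -> A, x = \sum_i c i *: g i.

Definition projective (A : comPzRingType) (P : lmodType A) : Prop :=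
  forall (M N : lmodType A) (g : {linear M -> N}) (f : {linear P -> N}),
    (forall y, exists x, g x = y) ->
    exists h : {linear P -> M}, forall x, g (h x) = f x.

Definition bounded_below (A : comPzRingType) (K : cochain_complex A) : Prop :=
  exists m : int, forall i, i < m -> is_zero (K i).

Definition generates (A : comPzRingType) (r : nat) (a : 'I_r -> A)
    (I : submodule A^o) : Prop :=
  forall x : A, x \in I <-> exists c : 'I_r -> A, x = \sum_i c i * a i.

Definition noetherian (A : comPzRingType) : Prop :=
  forall I : submodule A^o, exists (r : nat) (a : 'I_r -> A), generates a I.

Definition prime_ideal (A : comPzRingType) (P : submodule A^o) : Prop :=
  (1 : A) \notin P /\
  forall x y : A, x * y \in P -> x \in P \/ y \in P.

(* The lengths of the chains P_0 < ... < P_l of primes are bounded. *)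
Definition finite_dimensional (A : comPzRingType) : Prop :=
  exists d : nat, forall (l : nat) (P : 'I_l.+1 -> submodule A^o),
    (forall i, prime_ideal (P i)) ->
    (forall i j : 'I_l.+1, (i < j)%N ->
       {subset P i <= P j} /\ ~ {subset P j <= P i}) ->
    (l <= d)%N.

(* A spectral sequence starting at E_2: the pages 0 and 1 are irrelevant.  As
   for complexes, the differential is indexed by its source (p, q) and its
   target (p', q'). *)
Record spectral_sequence (A : comPzRingType) := SpectralSequence {
  page :> nat -> int -> int -> lmodType A;
  pdiff : forall r p q p' q', {linear page r p q -> page r p' q'};
  pdiff_shape : forall r p q p' q', (p', q') != (p + r%:Z, q - r%:Z + 1) ->
    forall x, pdiff r p q p' q' x = 0;
  pdiff_comp : forall r p q p' q' p'' q'' x,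
    pdiff r p' q' p'' q'' (pdiff r p q p' q' x) = 0;
  page_next : forall r p q, (2 <= r)%N ->
    page r.+1 p q ≃ homology (pdiff r (p - r%:Z) (q + r%:Z - 1) p q)
                             (pdiff r p q (p + r%:Z) (q - r%:Z + 1))
}.

(* All differentials out of and into position (p, q) vanish from page r on, so
   that E_r^{p,q} is the limit term. *)
Definition stable_from (A : comPzRingType) (E : spectral_sequence A)
    (r : nat) (p q : int) : Prop :=
  forall s p' q', (r <= s)%N ->
    (forall x, pdiff E s p q p' q' x = 0) /\
    (forall x, pdiff E s p' q' p q x = 0).

(* E_2^{p,q} => H^{p+q}: every position stabilizes, and each H^m carries a
   finite decreasing filtration whose p-th graded piece is the limit term at
   (p, m - p). *)
Definition converges_to (A : comPzRingType) (E : spectral_sequence A)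
    (H : int -> lmodType A) : Prop :=
  (forall p q, exists2 r, (2 <= r)%N & stable_from E r p q) /\
  exists F : forall m : int, int -> submodule (H m),
    [/\ forall m p p', p <= p' -> {subset F m p' <= F m p},
        forall m, exists p, forall x, x \in F m p,
        forall m, exists p, forall x, x \in F m p -> x = 0
      & forall r p q, (2 <= r)%N -> stable_from E r p q ->
          E r p q ≃ subquo (F (p + q) p) (F (p + q) (p + 1))].

(* Main.v *)
Require Import Defs.
From HB Require Import structures.
From mathcomp Require Import all_boot all_order all_algebra.
From mathcomp Require Import boolp zify ring.

(** The spectral sequence is that of a double complex.  Put
    L^q = Hom(K^-q, A) and C^{p,q} = Cech^p(L^q), where Cech^p vanishes unless
    0 <= p <= r, and filter the total complex by p.  Only finitely many columns
    are nonzero, so the filtration is finite in each degree and the spectral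
    sequence converges to the cohomology of the total complex
    ([filtered_converges]).

    The two iterated cohomologies of C are computed separately.  Localization
    is exact, so along q the cohomology of C^{p,*} is Cech^p(H^q(L))
    ([cech_homology_presents]), and the second page is H^p_I(H^q(L))
    ([second_page]).  Since K^-q is projective of finite type, evaluation is an
    isomorphism Cech^p(Hom(K^-q, A)) ~ Hom(K^-q, Cech^p(A)) ([cech_eval_bij]),
    and Hom(K^-q, -) is exact; so along p the cohomology of C^{*,q} is
    Hom(K^-q, H^p_I(A)) ([cech_dual_presents]).  By assumption this vanishes for
    p <> n, and a double complex with finitely many columns whose rows are exact
    outside column n has the total cohomology of the complex formed in
    column n, shifted by n ([abutment_presents]).

    Cohomology modules and pages of spectral sequences are subquotients, and most
    of the work is to compare two subquotients of related modules.  They are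
    therefore handled through linear relations:
    [presents Z B R] says that R relates the elements of Z to their classes in
    a module Q and identifies Q with Z / B.  Two modules are isomorphic once a
    linear relation between them is total, onto, and kills nothing on either
    side ([linear_rel_iso]). *)

Set Implicit Arguments.
Unset Strict Implicit.
Unset Printing Implicit Defensive.

Import Order.TTheory GRing.Theory Num.Theory.
Local Open Scope ring_scope.

(* The algebra of vector spaces uses the same name for its linear maps. *)
Local Notation Hom := Defs.Hom.

(** * Linear relations and presentations of subquotients *)

Section Submodules.
Variables (A : comPzRingType) (M : lmodType A) (P : M -> Prop).
Hypotheses (P0 : P 0) (PD : forall a x y, P x -> P y -> P (a *: x + y)).

Fact submodule_of_closed : submod_closed (fun x : M => `[< P x >]).
Proof.
split=> [|a x y]; first exact/asboolP.
by move=> /asboolP Px /asboolP Py; apply/asboolP; exact: PD.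
Qed.

Definition submodule_of : submodule M := Submodule submodule_of_closed.

Lemma submodule_ofE x : (x \in submodule_of) <-> P x.
Proof. by split=> [/asboolP|Px]; last exact/asboolP. Qed.

End Submodules.

Lemma submod_lift (A : comPzRingType) (M : lmodType A) (S : submodule M) x :
  x \in S -> exists u : submod S, val u = x.
Proof. by move=> xS; exists (Sub x xS); rewrite SubK. Qed.

(** The nonempty linear relations are the submodules of M x N. *)
Definition linear_rel (A : comPzRingType) (M N : lmodType A)
    (R : M -> N -> Prop) : Prop :=
  forall a x y x' y', R x y -> R x' y' -> R (a *: x + x') (a *: y + y').

Section LinearRelations.
Variables (A : comPzRingType) (M N : lmodType A) (R : M -> N -> Prop).
Hypothesis Rlin : linear_rel R.

Lemma linear_relD x y x' y' : R x y -> R x' y' -> R (x + x') (y + y').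
Proof. by move=> h h'; have := Rlin 1 h h'; rewrite !scale1r. Qed.

Lemma linear_relB x y x' y' : R x y -> R x' y' -> R (x - x') (y - y').
Proof.
by move=> h h'; have := Rlin (-1) h' h; rewrite !scaleN1r ![- _ + _]addrC.
Qed.

Lemma linear_rel00 x y : R x y -> R 0 0.
Proof. by move=> h; have := linear_relB h h; rewrite !subrr. Qed.

Lemma linear_relZ a x y : R x y -> R (a *: x) (a *: y).
Proof.
by move=> h; have := Rlin a h (linear_rel00 h); rewrite !addr0.
Qed.

Lemma linear_rel_sum (J : finType) (P : {pred J}) (x : J -> M) (y : J -> N) :
  R 0 0 -> (forall j, j \in P -> R (x j) (y j)) ->
  R (\sum_(j in P) x j) (\sum_(j in P) y j).
Proof.
by move=> R0 Rxy; elim/big_ind2: _ => // x1 x2 y1 y2; exact: linear_relD.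
Qed.

Lemma linear_rel_fun : (forall x, exists y, R x y) -> (forall y, R 0 y -> y = 0) ->
  exists f : {linear M -> N}, forall x y, R x y <-> y = f x.
Proof.
move=> tot fun0; have [f Rf] := choice tot.
have Rfun x y : R x y -> y = f x.
  move=> h; apply/eqP; rewrite -subr_eq0; apply/eqP/fun0.
  by rewrite -(subrr x); exact: linear_relB.
have flin : linear f.
  by move=> a x y; apply/esym/Rfun; exact: Rlin.
pose fL : {linear M -> N} := HB.pack f (GRing.isLinear.Build _ _ _ _ f flin).
by exists fL => x y; split=> [/Rfun|->].
Qed.

Lemma linear_rel_iso : (forall x, exists y, R x y) -> (forall y, exists x, R x y) ->
  (forall y, R 0 y -> y = 0) -> (forall x, R x 0 -> x = 0) -> M ≃ N.
Proof.
move=> tot onto fun0 inj0; have [f fE] := linear_rel_fun tot fun0.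
have [g Rg] := choice onto.
exists f; exists g => [x|y]; last by apply/esym/fE.
apply/eqP; rewrite -subr_eq0; apply/eqP/inj0.
by rewrite -(subrr (f x)); apply: linear_relB => //; exact/fE.
Qed.

End LinearRelations.

Section Presentations.
Variables (A : comPzRingType) (M Q : lmodType A).

(** R is the graph of a surjection Z -> Q with kernel B. *)
Record presents (Z B : M -> Prop) (R : M -> Q -> Prop) : Prop := Presents {
  presents_linear : linear_rel R;
  presents_dom : forall x, (exists y, R x y) <-> Z x;
  presents_onto : forall y, exists x, R x y;
  presents_ker : forall x, R x 0 <-> B x;
  presents_fun0 : forall y, R 0 y -> y = 0
}.

Variables (Z B : M -> Prop) (R : M -> Q -> Prop).
Hypothesis hR : presents Z B R.

Lemma presents_fun x y y' : R x y -> R x y' -> y = y'.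
Proof.
move=> h h'; apply/eqP; rewrite -subr_eq0; apply/eqP/(presents_fun0 hR).
by rewrite -(subrr x); exact: (linear_relB (presents_linear hR)).
Qed.

Lemma presents00 : R 0 0.
Proof.
by have [x] := presents_onto hR 0; exact: (linear_rel00 (presents_linear hR)).
Qed.

Lemma presents_eqv Z' B' : (forall x, Z x <-> Z' x) -> (forall x, B x <-> B' x) ->
  presents Z' B' R.
Proof.
case: hR => l d o k f hZ hB; split=> // x.
  by rewrite d; exact: hZ.
by rewrite k; exact: hB.
Qed.

End Presentations.

Section Class.
Variables (A : comPzRingType) (M : lmodType A) (Z B : submodule M).

Definition class_rel (x : M) (e : subquo Z B) : Prop :=
  exists s : submod Z, val s = x /\ e = quomod_class (submod_trace Z B) s.

Lemma class_rel_presents :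
  presents (fun x => x \in Z) (fun x => x \in Z /\ x \in B) class_rel.
Proof.
have class0 (s : submod Z) : quomod_class (submod_trace Z B) s = 0 <-> val s \in B.
  rewrite -(linear0 (@quomod_class _ _ (submod_trace Z B))).
  by split=> [/eqP|sB]; [|apply/eqP]; rewrite quomod_classE subr0.
split.
- move=> a x e x' e' [s [<- ->]] [s' [<- ->]]; exists (a *: s + s').
  by rewrite !linearP.
- move=> x; split=> [[e [s [<- _]]]|xZ]; first exact: valP.
  by exists (quomod_class (submod_trace Z B) (Sub x xZ)), (Sub x xZ); rewrite SubK.
- move=> e; have [s ->] := quomod_classP e; by exists (val s), s.
- move=> x; split=> [[s [<- /esym/class0 sB]]|[xZ xB]].
    by split; first exact: valP.
  exists (Sub x xZ); rewrite SubK; split=> //; apply/esym/class0.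
  by rewrite SubK.
- move=> e [s [s0 ->]]; apply/class0; rewrite s0; exact: rpred0.
Qed.

End Class.

(** Under g o f = 0 the intersection of the image of f with the kernel of g in
    the definition of homology disappears. *)
Lemma homology_presents (A : comPzRingType) (L M N : lmodType A)
    (f : {linear L -> M}) (g : {linear M -> N}) :
  (forall w, g (f w) = 0) ->
  presents (fun x => g x = 0) (fun x => exists w, f w = x)
    (@class_rel _ _ (ker g) (im f)).
Proof.
move=> gf; apply: (presents_eqv (class_rel_presents _ _)) => x.
  by split=> [/eqP|/eqP].
split=> [[_ /asboolP//]|[w <-]]; split; first by apply/eqP.
by apply/asboolP; exists w.
Qed.

(** * The spectral sequence of a filtered complex *)

Lemma homology_of_zero_maps (A : comPzRingType) (L M N : lmodType A)
    (f : {linear L -> M}) (g : {linear M -> N}) :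
  (forall w, f w = 0) -> (forall x, g x = 0) -> M ≃ homology f g.
Proof.
move=> f0 g0; have gf w : g (f w) = 0 by rewrite f0 linear0.
have hH := homology_presents gf.
apply: (linear_rel_iso (presents_linear hH)).
- by move=> x; apply/(presents_dom hH).
- exact: (presents_onto hH).
- exact: (presents_fun0 hH).
- by move=> x /(presents_ker hH)[w <-].
Qed.

Lemma lin_iso_refl (A : pzRingType) (M : lmodType A) : M ≃ M.
Proof. by exists idfun; exists idfun. Qed.

Lemma lin_iso_trans (A : pzRingType) (M N P : lmodType A) :
  M ≃ N -> N ≃ P -> M ≃ P.
Proof.
move=> [f bf] [g bg]; exists (g \o f : {linear M -> P}).
exact: bij_comp.
Qed.

Lemma lin_iso_sym (A : pzRingType) (M N : lmodType A) : M ≃ N -> N ≃ M.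
Proof.
move=> [f [g fK gK]].
have glin : linear g.
  by move=> a x y; apply: (can_inj fK); rewrite linearP !gK.
pose gL : {linear N -> M} := HB.pack g (GRing.isLinear.Build _ _ _ _ g glin).
by exists gL; exists f.
Qed.

(** The whole complex is one module W with an endomorphism D of square zero;
    X p m is the p-th step of the filtration in degree m.  Keeping all degrees
    inside W avoids transports between components of equal degree.  That D
    raises the degree by one is imposed on cycles instead of on D. *)
Section FilteredComplex.
Variables (A : comPzRingType) (W : lmodType A) (D : {linear W -> W}).
Variable X : int -> int -> submodule W.
Hypothesis DD : forall x, D (D x) = 0.
Hypothesis Xdec : forall p p' m, p <= p' -> {subset X p' m <= X p m}.

Section Page.
Variables (r : nat) (p q : int).

Definition page_cycle (x : W) : Prop :=
  x \in X p (p + q) /\ D x \in X (p + r%:Z) (p + q + 1).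

(** The usual boundaries are Z_{r-1}^{p+1} + D Z_{r-1}^{p-r+1}.  On an
    r-cycle x = y + D z the extra conditions are automatic: D y = D x lies in
    step p + r, and D z = x - y lies in step p. *)
Definition page_boundary (x : W) : Prop :=
  exists y z, [/\ y \in X (p + 1) (p + q), z \in X (p - r%:Z + 1) (p + q - 1)
                & x = y + D z].

Fact page_cycle0 : page_cycle 0.
Proof. by rewrite /page_cycle linear0 !rpred0. Qed.

Fact page_cycleD a x y : page_cycle x -> page_cycle y -> page_cycle (a *: x + y).
Proof.
move=> [x1 x2] [y1 y2]; rewrite /page_cycle linearP.
by split; apply: rpredD => //; apply: rpredZ.
Qed.

Fact page_boundary0 : page_boundary 0.
Proof. by exists 0, 0; rewrite linear0 addr0 !rpred0. Qed.

Fact page_boundaryD a x y :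
  page_boundary x -> page_boundary y -> page_boundary (a *: x + y).
Proof.
move=> [x1 [x2 [hx1 hx2 ->]]] [y1 [y2 [hy1 hy2 ->]]].
exists (a *: x1 + y1), (a *: x2 + y2).
split; try by apply: rpredD => //; apply: rpredZ.
by rewrite linearP scalerDr addrACA.
Qed.

Definition filtered_page : lmodType A :=
  subquo (submodule_of page_cycle0 page_cycleD)
         (submodule_of page_boundary0 page_boundaryD).

Definition page_class : W -> filtered_page -> Prop := @class_rel _ _ _ _.

Lemma page_presents :
  presents page_cycle (fun x => page_cycle x /\ page_boundary x) page_class.
Proof.
by apply: (presents_eqv (class_rel_presents _ _)) => x; rewrite !submodule_ofE.
Qed.

Lemma page_cycleB x y : page_cycle x -> page_cycle y -> page_cycle (x - y).
Proof.
by move=> hx hy; rewrite addrC -scaleN1r; exact: page_cycleD.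
Qed.

Lemma page_class_cycle x e : page_class x e -> page_cycle x.
Proof. by move=> h; apply/(presents_dom page_presents); exists e. Qed.

Lemma page_class_eq x x' e : page_class x e -> page_cycle x' ->
  page_boundary (x - x') -> page_class x' e.
Proof.
move=> h h' hb.
have hx := page_class_cycle h.
have hd : page_class (x - x') 0.
  by apply/(presents_ker page_presents); split=> //; exact: page_cycleB.
by have := linear_relB (presents_linear page_presents) h hd;
  rewrite subr0 opprB addrCA subrr addr0.
Qed.

End Page.

Lemma page_cycle_D r p q p' q' x : p' = p + r%:Z -> q' = q - r%:Z + 1 ->
  page_cycle r p q x -> page_cycle r p' q' (D x).
Proof.
move=> -> -> [_ Dx]; rewrite /page_cycle DD rpred0; split=> //.
by have -> : p + r%:Z + (q - r%:Z + 1) = p + q + 1 by ring.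
Qed.

Lemma page_boundary_D r p q p' q' x : p' = p + r%:Z -> q' = q - r%:Z + 1 ->
  page_boundary r p q x -> page_boundary r p' q' (D x).
Proof.
move=> -> -> [y [z [hy hz ->]]]; exists 0, y; rewrite rpred0.
rewrite linearD DD addr0 add0r; split=> //.
have -> : p + r%:Z + (q - r%:Z + 1) - 1 = p + q by ring.
by have -> : p + r%:Z - r%:Z + 1 = p + 1 by ring.
Qed.

Definition page_diff_graph r p q p' q'
    (e : filtered_page r p q) (e' : filtered_page r p' q') : Prop :=
  if (p', q') == (p + r%:Z, q - r%:Z + 1)
  then exists x, page_class x e /\ page_class (D x) e'
  else e' = 0.

Lemma page_diff_exists r p q p' q' :
  exists f : {linear filtered_page r p q -> filtered_page r p' q'},
    forall e e', page_diff_graph e e' <-> e' = f e.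
Proof.
have hP := page_presents r p q; have hP' := page_presents r p' q'.
rewrite /page_diff_graph; apply: linear_rel_fun; case: eqP => [[pE qE]|_].
- move=> a e1 e1' e2 e2' [x [h1 h1']] [y [h2 h2']].
  exists (a *: x + y); rewrite linearP.
  by split; [exact: (presents_linear hP)|exact: (presents_linear hP')].
- by move=> a e1 e1' e2 e2' -> ->; rewrite scaler0 addr0.
- move=> e; have [x xe] := presents_onto hP e.
  have [|e' he'] := (presents_dom hP' (D x)).2; last by exists e', x.
  exact: (page_cycle_D pE qE (page_class_cycle xe)).
- by exists 0.
- move=> e [x [/(presents_ker hP)[xc xb] Dxe]].
  apply: (presents_fun hP' Dxe); apply/(presents_ker hP'); split.
    exact: (page_cycle_D pE qE).
  exact: (page_boundary_D pE qE).
- by [].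
Qed.

Definition page_diff r p q p' q' :
    {linear filtered_page r p q -> filtered_page r p' q'} :=
  projT1 (cid (page_diff_exists r p q p' q')).

Lemma page_diffE r p q p' q' e e' :
  page_diff_graph e e' <-> e' = page_diff r p q p' q' e.
Proof. exact: (projT2 (cid (page_diff_exists r p q p' q'))). Qed.

Lemma page_diff_shape r p q p' q' :
  (p', q') != (p + r%:Z, q - r%:Z + 1) -> forall e, page_diff r p q p' q' e = 0.
Proof.
by move=> h e; apply/esym/page_diffE; rewrite /page_diff_graph (negbTE h).
Qed.

Lemma page_diff_class r p q p' q' x e : p' = p + r%:Z -> q' = q - r%:Z + 1 ->
  page_class x e -> page_class (D x) (page_diff r p q p' q' e).
Proof.
move=> pE qE xe; have /page_diffE := erefl (page_diff r p q p' q' e).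
rewrite /page_diff_graph; case: eqP => [_ [y [ye yDe]]|[]]; last by rewrite pE qE.
have hb : page_class (x - y) (0 : filtered_page r p q).
  by rewrite -(subrr e); apply: (linear_relB (presents_linear (page_presents r p q))).
have [xyc xyb] := (presents_ker (page_presents r p q) _).1 hb.
apply: (page_class_eq yDe).
  exact: (page_cycle_D pE qE (page_class_cycle xe)).
rewrite -linearB -opprB linearN.
have := page_boundary_D pE qE xyb => h.
by rewrite -scaleN1r -[_ *: _]addr0; apply: page_boundaryD => //; exact: page_boundary0.
Qed.

Lemma page_diff_comp r p q p' q' p'' q'' e :
  page_diff r p' q' p'' q'' (page_diff r p q p' q' e) = 0.
Proof.
have [[pE qE]|h] := eqVneq (p', q') (p + r%:Z, q - r%:Z + 1); last first.
  by rewrite (page_diff_shape h) linear0.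
have [[pE' qE']|h] := eqVneq (p'', q'') (p' + r%:Z, q' - r%:Z + 1); last first.
  by rewrite (page_diff_shape h).
have [x xe] := presents_onto (page_presents r p q) e.
have := page_diff_class pE' qE' (page_diff_class pE qE xe).
by rewrite DD; exact: (presents_fun0 (page_presents r p'' q'')).
Qed.

(** A class of the r-th page killed by the differential has D x = y + D z with y
    one step deeper than required; then x - z is an (r+1)-cycle in the same
    class.  The new boundaries are exactly the images D z of the r-cycles z of
    position p - r, up to old boundaries. *)
Lemma page_succ r p q :
  filtered_page r.+1 p q ≃ homology (page_diff r (p - r%:Z) (q + r%:Z - 1) p q)
                                    (page_diff r p q (p + r%:Z) (q - r%:Z + 1)).
Proof.
set f := page_diff _ _ _ p q; set g := page_diff _ p q _ _.
have gf w : g (f w) = 0 by exact: page_diff_comp.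
have hH := homology_presents gf.
have hN := page_presents r.+1 p q; have hP := page_presents r p q.
have hP' := page_presents r (p + r%:Z) (q - r%:Z + 1).
have pE : p = p - r%:Z + r%:Z by ring.
have qE : q = q + r%:Z - 1 - r%:Z + 1 by ring.
pose R (e' : filtered_page r.+1 p q) (h : homology f g) :=
  exists x e, [/\ page_class x e', page_class x e & @class_rel _ _ (ker g) (im f) e h].
have cycS x : page_cycle r.+1 p q x -> page_cycle r p q x.
  by move=> [xX DxX]; split=> //; apply: Xdec DxX; lia.
apply: (@linear_rel_iso _ _ _ R).
- move=> a e1 h1 e2 h2 [x1 [u1 [a1 b1 c1]]] [x2 [u2 [a2 b2 c2]]].
  exists (a *: x1 + x2), (a *: u1 + u2).
  by split; apply: presents_linear; try eassumption.
- move=> e'; have [x xe'] := presents_onto hN e'.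
  have [xX DxX] := page_class_cycle xe'.
  have [e xe] := (presents_dom hP x).2 (cycS _ (page_class_cycle xe')).
  have ge : g e = 0.
    apply: (presents_fun hP' (page_diff_class erefl erefl xe)).
    apply/(presents_ker hP'); split.
      exact: (page_cycle_D erefl erefl (page_class_cycle xe)).
    exists (D x), 0; rewrite linear0 addr0 rpred0; split=> //.
    have -> : p + r%:Z + 1 = p + r.+1%:Z by lia.
    by have -> : p + r%:Z + (q - r%:Z + 1) = p + q + 1 by ring.
  have [h eh] := (presents_dom hH e).2 ge.
  by exists h, x, e.
- move=> h; have [e eh] := presents_onto hH h.
  have ge : g e = 0 by apply/(presents_dom hH); exists h.
  have [x xe] := presents_onto hP e.
  have := page_diff_class erefl erefl xe; rewrite -/g ge.
  move=> /(presents_ker hP')[_ [y [z [hy hz DxE]]]].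
  have {}hy : y \in X (p + r.+1%:Z) (p + q + 1).
    have <- : p + r%:Z + 1 = p + r.+1%:Z by lia.
    by have <- : p + r%:Z + (q - r%:Z + 1) = p + q + 1 by ring.
  have {}hz : z \in X (p + 1) (p + q).
    have <- : p + r%:Z - r%:Z + 1 = p + 1 by ring.
    by have <- : p + r%:Z + (q - r%:Z + 1) - 1 = p + q by ring.
  have xc : page_cycle r.+1 p q (x - z).
    have [xX _] := page_class_cycle xe; split.
      by apply: rpredB => //; apply: Xdec hz; lia.
    by rewrite linearB DxE addrK.
  have [e' he'] := (presents_dom hN _).2 xc.
  exists e', (x - z), e; split=> //.
  apply: (page_class_eq xe); first exact: cycS.
  by exists z, 0; rewrite linear0 rpred0 opprB addrCA subrr.
- move=> h [x [e [/(presents_ker hN)[xc [y [z [hy hz xE]]]] xe eh]]].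
  apply: (presents_fun hH eh); apply/(presents_ker hH).
  have zc : page_cycle r (p - r%:Z) (q + r%:Z - 1) z.
    have zE : p - r%:Z + (q + r%:Z - 1) = p + q - 1 by ring.
    split; rewrite zE.
      by have <- : p - r.+1%:Z + 1 = p - r%:Z by lia.
    rewrite !subrK; have -> : D z = x - y by rewrite xE addrC addKr.
    by apply: rpredB; [case: xc|apply: Xdec hy; lia].
  have [w zw] := (presents_dom (page_presents _ _ _) z).2 zc.
  exists w; have Dzw := page_diff_class pE qE zw.
  apply: (presents_fun hP) xe; apply: (page_class_eq Dzw); first exact: cycS.
  exists (- y), 0; rewrite linear0 rpredN rpred0; split=> //.
  by rewrite xE opprD addrCA subrr.
- move=> e' [x [e [xe' xe /(presents_ker hH)[w we]]]].
  apply: (presents_fun hN xe'); apply/(presents_ker hN).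
  split; first exact: page_class_cycle xe'.
  have [z zw] := presents_onto (page_presents _ _ _) w.
  have := page_diff_class pE qE zw; rewrite -/f we => Dze.
  have : page_class (x - D z) (e - e) by exact: (linear_relB (presents_linear hP)).
  rewrite subrr => /(presents_ker hP)[_ [y [z' [hy hz' xE]]]].
  exists y, (z + z'); split=> //.
    have zE : p - r%:Z + (q + r%:Z - 1) = p + q - 1 by ring.
    apply: rpredD; last by apply: Xdec hz'; lia.
    have [] := page_class_cycle zw; rewrite zE => hz _.
    by have -> : p - r.+1%:Z + 1 = p - r%:Z by lia.
  by rewrite linearD [D z + _]addrC addrA -xE subrK.
Qed.

Definition filtered_spectral_sequence : spectral_sequence A :=
  @SpectralSequence A filtered_page page_diff page_diff_shape page_diff_comp
    (fun r p q _ => page_succ r p q).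

Lemma stable_pages (r s : nat) p q : (2 <= r)%N -> (r <= s)%N ->
  stable_from filtered_spectral_sequence r p q ->
  filtered_page r p q ≃ filtered_page s p q.
Proof.
move=> r2 rs st; rewrite -(subnKC rs); elim: (s - r)%N => [|k IH].
  by rewrite addn0; exact: lin_iso_refl.
rewrite addnS; apply: (lin_iso_trans IH); apply: lin_iso_sym.
apply: (lin_iso_trans (page_succ _ _ _)); apply: lin_iso_sym.
apply: homology_of_zero_maps => x.
  by have [_ ->] := st (r + k)%N (p - (r + k)%:Z) (q + (r + k)%:Z - 1) (leq_addr _ _).
by have [-> _] := st (r + k)%N (p + (r + k)%:Z) (q - (r + k)%:Z + 1) (leq_addr _ _).
Qed.

Section Convergence.
Variables lo hi : int.
Hypothesis Xlo : forall p m, p <= lo -> {subset X p m <= X lo m}.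
Hypothesis Xhi : forall p m x, hi < p -> x \in X p m -> x = 0.

Lemma filtration_lo p m x : x \in X p m -> x \in X lo m.
Proof. by have [/Xlo|/ltW /Xdec] := leP p lo; apply. Qed.

(** An arrow longer than the filtration leaves or enters a position outside it:
    below lo every cycle is a boundary, since the filtration is constant there,
    and above hi there is nothing. *)
Lemma page_diff_late s p q p' q' : hi - lo < s%:Z ->
  forall e, page_diff s p q p' q' e = 0.
Proof.
move=> s_large e.
have [[pE qE]|h] := eqVneq (p', q') (p + s%:Z, q - s%:Z + 1); last first.
  exact: page_diff_shape.
have hP := page_presents s p q; have hP' := page_presents s p' q'.
have [x xe] := presents_onto hP e; have [xX DxX] := page_class_cycle xe.
have [ps|ps] := ltP hi (p + s%:Z).
  have := page_diff_class pE qE xe; rewrite (Xhi ps DxX).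
  exact: (presents_fun0 hP').
suff -> : e = 0 by rewrite linear0.
apply: (presents_fun hP xe); apply/(presents_ker hP); split=> //.
exists x, 0; rewrite linear0 addr0 rpred0; split=> //.
by apply: (@Xdec _ lo); [lia|exact: filtration_lo xX].
Qed.

Variables (H : int -> lmodType A) (R : forall m, W -> H m -> Prop).
Hypothesis hR : forall m, presents
  (fun x => x \in X lo m /\ D x = 0)
  (fun x => exists2 w, w \in X lo (m - 1) & x = D w) (@R m).

(** The filtration that X induces on the cohomology of the total complex. *)
Definition abutment_filtration_pred m p (h : H m) : Prop :=
  exists2 x, x \in X p m & R x h.

Fact abutment_filtration0 m p : @abutment_filtration_pred m p 0.
Proof. by exists 0; [exact: rpred0|exact: presents00 (hR m)]. Qed.

Fact abutment_filtrationD m p a h h' :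
  @abutment_filtration_pred m p h -> @abutment_filtration_pred m p h' ->
  @abutment_filtration_pred m p (a *: h + h').
Proof.
move=> [x xX xh] [y yX yh]; exists (a *: x + y).
  by apply: rpredD => //; exact: rpredZ.
exact: (presents_linear (hR m)).
Qed.

Definition abutment_filtration m p : submodule (H m) :=
  submodule_of (@abutment_filtration0 m p) (@abutment_filtrationD m p).

Lemma abutment_filtrationE m p h :
  h \in abutment_filtration m p <-> exists2 x, x \in X p m & R x h.
Proof. exact: submodule_ofE. Qed.

(** For large s an s-cycle is a cocycle, because D x lies beyond the last step,
    and the elements D z in the boundaries are all the coboundaries, because z
    ranges over the whole complex. *)
Lemma late_page_graded (s : nat) p q : hi < p + s%:Z -> p - s%:Z + 1 <= lo ->
  filtered_page s p q ≃
  subquo (abutment_filtration (p + q) p) (abutment_filtration (p + q) (p + 1)).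
Proof.
move=> hs ls; set F := abutment_filtration _ p; set F' := abutment_filtration _ _.
have hP := page_presents s p q; have hG := class_rel_presents F F'.
have hH := hR (p + q).
pose S (e : filtered_page s p q) (h : subquo F F') :=
  exists x k, [/\ page_class x e, R x k & class_rel k h].
apply: (@linear_rel_iso _ _ _ S).
- move=> a e1 h1 e2 h2 [x1 [u1 [a1 b1 c1]]] [x2 [u2 [a2 b2 c2]]].
  exists (a *: x1 + x2), (a *: u1 + u2).
  by split; apply: presents_linear; try eassumption.
- move=> e; have [x xe] := presents_onto hP e; have [xX DxX] := page_class_cycle xe.
  have [k xk] : exists k, @R (p + q) x k.
    by apply/(presents_dom hH); split; [exact: filtration_lo xX|exact: Xhi DxX].
  have [h kh] : exists h, @class_rel _ _ F F' k h.
    by apply/(presents_dom hG)/abutment_filtrationE; exists x.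
  by exists h, x, k.
- move=> h; have [k kh] := presents_onto hG h.
  have /abutment_filtrationE[x xX xk] : k \in F by apply/(presents_dom hG); exists h.
  have [_ Dx] : x \in X lo (p + q) /\ D x = 0 by apply/(presents_dom hH); exists k.
  have [e xe] : exists e, @page_class s p q x e.
    by apply/(presents_dom hP); split=> //; rewrite Dx rpred0.
  by exists e, x, k.
- move=> h [x [k [/(presents_ker hP)[_ [y [z [yX zX xE]]]] xk kh]]].
  apply: (presents_fun hG kh); apply/(presents_ker hG); split.
    by apply/(presents_dom hG); exists h.
  have Dz0 : @R (p + q) (D z) 0.
    by apply/(presents_ker hH); exists z => //; exact: filtration_lo zX.
  apply/abutment_filtrationE; exists y => //.
  by have := linear_relB (presents_linear hH) xk Dz0; rewrite xE addrK subr0.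
- move=> e [x [k [xe xk /(presents_ker hG)[_ /abutment_filtrationE[y yX yk]]]]].
  apply: (presents_fun hP xe); apply/(presents_ker hP).
  split; first exact: page_class_cycle xe.
  have := linear_relB (presents_linear hH) xk yk.
  rewrite subrr => /(presents_ker hH)[w wX xyE].
  exists y, w; split=> //; first by apply: Xdec wX.
  by rewrite -xyE addrC subrK.
Qed.

Lemma filtered_converges : converges_to filtered_spectral_sequence H.
Proof.
have late (s : nat) p q p' q' : (`|hi - lo|.+2 <= s)%N ->
    forall e, page_diff s p q p' q' e = 0.
  by move=> hs; apply: page_diff_late; lia.
split.
  move=> p q; exists `|hi - lo|.+2 => // s p' q' hs.
  by split=> x; exact: (late s).
exists abutment_filtration; split.
- move=> m p p' pp' h /abutment_filtrationE[x xX xh].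
  by apply/abutment_filtrationE; exists x => //; exact: Xdec xX.
- move=> m; exists lo => h; have [x xh] := presents_onto (hR m) h.
  have [xX _] : x \in X lo m /\ D x = 0 by apply/(presents_dom (hR m)); exists h.
  by apply/abutment_filtrationE; exists x.
- move=> m; exists (hi + 1) => h /abutment_filtrationE[x xX].
  have -> : x = 0 by apply: Xhi xX; rewrite ltrDl.
  exact: (presents_fun0 (hR m)).
- move=> r p q r2 st.
  have [s [rs hs ls]] : exists s : nat,
      [/\ (r <= s)%N, hi < p + s%:Z & p - s%:Z + 1 <= lo].
    by exists (r + `|hi - p| + `|p - lo|).+2; split; lia.
  exact: lin_iso_trans (stable_pages r2 rs st) (late_page_graded q hs ls).
Qed.

End Convergence.
End FilteredComplex.

(** * Double complexes with finitely many columns *)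

(** The total complex in all degrees at once is the product of all C p q; its
    part of degree m consists of the families supported on p + q = m.  Both
    differentials carry their source and target indices, so that
    [total_diffE] can be used at indices that are only provably equal to
    p - 1 and q - 1. *)
Section DoubleComplex.
Variables (A : comPzRingType) (C : int -> int -> lmodType A).

Definition bigraded : lmodType A :=
  prodmod (fun p => prodmod (C p) : lmodType A).

Implicit Types x z : bigraded.

Fact entryD x z p q : (x + z) p q = x p q + z p q. Proof. by []. Qed.
Fact entryN x p q : (- x) p q = - x p q. Proof. by []. Qed.
Fact entryZ a x p q : (a *: x) p q = a *: x p q. Proof. by []. Qed.
Fact entry0 p q : (0 : bigraded) p q = 0. Proof. by []. Qed.
Let entryE := (entryD, entryN, entryZ, entry0).

Lemma bigraded_ext x z : (forall p q, x p q = z p q) -> x = z.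
Proof.
by move=> xz; apply: functional_extensionality_dep => p;
  apply: functional_extensionality_dep => q.
Qed.

(** The casts transport c along the equalities p = i and q = j. *)
Definition single p q (c : C p q) : bigraded := fun i j =>
  match @eqP _ p i, @eqP _ q j with
  | ReflectT e, ReflectT e' => ecast k (C i k) e' (ecast k (C k q) e c)
  | _, _ => 0
  end.

Lemma singleE p q c : @single p q c p q = c.
Proof.
rewrite /single; case: eqP => // e; case: eqP => // e'.
by rewrite !eq_axiomK.
Qed.

Lemma single_out p q c i j : (i != p) || (j != q) -> @single p q c i j = 0.
Proof.
move=> h; rewrite /single; case: eqP => // pi; case: eqP => // qj.
by exfalso; move: h; rewrite -pi -qj !eqxx.
Qed.

Definition supported p m x : Prop :=
  forall i j, (i < p) || (i + j != m) -> x i j = 0.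

Fact supported0 p m : supported p m 0.
Proof. by []. Qed.

Fact supportedD p m a x z :
  supported p m x -> supported p m z -> supported p m (a *: x + z).
Proof. by move=> hx hz i j h; rewrite !entryE hx // hz // scaler0 addr0. Qed.

Definition column_filtration p m : submodule bigraded :=
  submodule_of (@supported0 p m) (@supportedD p m).

Local Notation X := column_filtration.

Lemma column_filtrationE p m x : x \in X p m <-> supported p m x.
Proof. exact: submodule_ofE. Qed.

Lemma column_filtration_dec p p' m : p <= p' -> {subset X p' m <= X p m}.
Proof.
move=> pp' x /column_filtrationE hx; apply/column_filtrationE => i j h.
by apply: hx; move: h; lia.
Qed.

Lemma column_filtration_step p q m x : p + q = m ->
  x \in X p m -> x p q = 0 -> x \in X (p + 1) m.
Proof.
move=> <- /column_filtrationE hx xp; apply/column_filtrationE => i j h.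
have [ip|ip] := eqVneq i p; last by apply: hx; move: h ip; lia.
have [jq|jq] := eqVneq j q; first by rewrite ip jq.
by apply: hx; move: jq; lia.
Qed.

Lemma single_supported p q c p' m : p + q = m -> p' <= p -> @single p q c \in X p' m.
Proof.
move=> <- pp'; apply/column_filtrationE => i j h.
by rewrite single_out //; move: h; lia.
Qed.

Variable d1 : forall q p p', {linear C p q -> C p' q}.
Variable d2 : forall p q q', {linear C p q -> C p q'}.
Hypothesis d1d1 : forall q p p' p'' c, d1 q p' p'' (d1 q p p' c) = 0.
Hypothesis d2d2 : forall p q q' q'' c, d2 p q' q'' (d2 p q q' c) = 0.
Hypothesis d12 : forall p p' q q' c,
  d1 q' p p' (d2 p q q' c) = d2 p' q q' (d1 q p p' c).

(** The directions d1 and d2 commute; alternating the sign of d2 with p makes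
    the total differential square to zero. *)
Definition column_sign (p : int) : A := (-1) ^+ `|p|%N.

Lemma column_signB1 p : column_sign (p - 1) = - column_sign p.
Proof.
rewrite /column_sign; have [p0|p0] := ltP 0 p.
  have -> : `|p|%N = `|p - 1|%N.+1 by lia.
  by rewrite exprS mulN1r opprK.
have -> : `|p - 1|%N = `|p|%N.+1 by lia.
by rewrite exprS mulN1r.
Qed.

Lemma column_signK p (M : lmodType A) (c : M) :
  column_sign p *: (column_sign p *: c) = c.
Proof. by rewrite scalerA -expr2 sqrr_sign scale1r. Qed.

Definition total_diff_fun x : bigraded := fun p q =>
  d1 q (p - 1) p (x (p - 1) q) + column_sign p *: d2 p (q - 1) q (x p (q - 1)).

Fact total_diff_linear : linear total_diff_fun.
Proof.
move=> a x y; apply: bigraded_ext => p q.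
rewrite !entryE /total_diff_fun !entryE !linearP /=.
by rewrite scalerDr addrACA.
Qed.

HB.instance Definition _ := GRing.isLinear.Build A bigraded bigraded *:%R
  total_diff_fun total_diff_linear.

Definition total_diff : {linear bigraded -> bigraded} := total_diff_fun.

Local Notation D := total_diff.

Lemma total_diffE i p j q x : i = p - 1 -> j = q - 1 ->
  D x p q = d1 q i p (x i q) + column_sign p *: d2 p j q (x p j).
Proof. by move=> -> ->. Qed.

Lemma total_diffK x : D (D x) = 0.
Proof.
apply: bigraded_ext => p q; rewrite entry0.
rewrite (total_diffE _ erefl erefl).
rewrite (@total_diffE (p - 1 - 1) (p - 1) (q - 1) q) //.
rewrite (@total_diffE (p - 1) p (q - 1 - 1) (q - 1)) //.
rewrite !linearD !linearZ_LR /= d1d1 d2d2 d12 column_signB1 add0r.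
by rewrite !scaler0 addr0 scaleNr addNr.
Qed.

Lemma total_diff_filtration p m x : x \in X p m -> D x \in X p (m + 1).
Proof.
move=> /column_filtrationE hx; apply/column_filtrationE => i j h.
rewrite (total_diffE _ erefl erefl) !hx ?linear0 ?scaler0 ?addr0 //;
  by move: h; lia.
Qed.

Variable b : int.
Hypothesis C_bound : forall p q : int, (p < 0) || (b < p) -> is_zero (C p q).

Lemma column_filtration_low p m : p <= 0 -> {subset X p m <= X 0 m}.
Proof.
move=> p0 x /column_filtrationE hx; apply/column_filtrationE => i j h.
have [i0|i0] := ltP i 0; first by apply: C_bound; rewrite i0.
by apply: hx; move: h i0; lia.
Qed.

Lemma column_filtration_high p m x : b < p -> x \in X p m -> x = 0.
Proof.
move=> bp /column_filtrationE hx; apply: bigraded_ext => i j.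
have [ip|ip] := ltP i p; first by rewrite hx ?ip.
by apply: C_bound; move: bp ip; lia.
Qed.

Definition double_complex_ss : spectral_sequence A :=
  filtered_spectral_sequence total_diffK column_filtration_dec.

Section SecondPage.
Variables (M : int -> int -> lmodType A) (R : forall p q, C p q -> M p q -> Prop).
Variable e : forall q p p', {linear M p q -> M p' q}.
Hypothesis hR : forall p q, presents (fun c => d2 p q (q + 1) c = 0)
  (fun c => exists v, d2 p (q - 1) q v = c) (@R p q).
Hypothesis eR : forall q p p' c h, R c h -> R (d1 q p p' c) (e q p p' h).

(** An element of the second page is represented by x in columns >= p with
    D x in columns >= p + 2: its entry c in column p satisfies d2 c = 0, and
    d1 c is a d2-boundary because the entry of x in column p + 1 accounts for
    it.  So the class of c in the cohomology M p q along d2 is an e-cocycle,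
    and the isomorphism sends the class of x to the class of that cocycle. *)
Lemma second_page p q :
  double_complex_ss 2%N p q ≃ homology (e q (p - 1) p) (e q p (p + 1)).
Proof.
have ee k : e q p (p + 1) (e q (p - 1) p k) = 0.
  have [c ck] := presents_onto (hR _ _) k.
  by have := eR (p + 1) (eR p ck); rewrite ?d1d1; exact: (presents_fun0 (hR _ _)).
have hH := homology_presents ee.
have hP := page_presents total_diff column_filtration 2 p q.
pose S (u : filtered_page D X 2 p q) (h : homology (e q (p - 1) p) (e q p (p + 1))) :=
  exists x y, [/\ page_class x u, R (x p q) y & class_rel y h].
rewrite -/(filtered_page D X 2 p q).
apply: (@linear_rel_iso _ _ _ S).
- move=> a u1 h1 u2 h2 [x1 [y1 [a1 b1 c1]]] [x2 [y2 [a2 b2 c2]]].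
  exists (a *: x1 + x2), (a *: y1 + y2).
  split; first exact: (presents_linear hP).
    by rewrite !entryE; exact: (presents_linear (hR _ _)).
  exact: (presents_linear hH).
- move=> u; have [x xu] := presents_onto hP u.
  have [/column_filtrationE xX /column_filtrationE DxX] := page_class_cycle xu.
  have d2x : d2 p q (q + 1) (x p q) = 0.
    have := DxX p (q + 1); rewrite (@total_diffE (p - 1) _ q) ?addrK //.
    rewrite (xX (p - 1)) ?linear0 ?add0r; last by lia.
    move=> /(_ _)/(congr1 (fun c => column_sign p *: c)).
    by rewrite column_signK scaler0; apply; lia.
  have [y xy] := (presents_dom (hR _ _) _).2 d2x.
  have ey : e q p (p + 1) y = 0.
    apply: (presents_fun (hR _ _) (eR (p + 1) xy)).
    apply/(presents_ker (hR _ _)).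
    have := DxX (p + 1) q; rewrite (@total_diffE p _ (q - 1)) ?addrK //.
    move=> /(_ _)/eqP; rewrite addr_eq0 -linearZ_LR -linearN => h.
    by eexists; apply/esym/eqP/h; lia.
  have [h yh] := (presents_dom hH _).2 ey.
  by exists h, x, y.
- move=> h; have [y yh] := presents_onto hH h.
  have ey : e q p (p + 1) y = 0 by apply/(presents_dom hH); exists h.
  have [c cy] := presents_onto (hR p q) y.
  have d2c : d2 p q (q + 1) c = 0 by apply/(presents_dom (hR p q)); exists y.
  have := eR (p + 1) cy; rewrite ey => /(presents_ker (hR _ _))[w wc].
  pose x := single c - column_sign (p + 1) *: single w.
  have xX : x \in X p (p + q).
    by apply: rpredB; [|apply: rpredZ]; apply: single_supported; lia.
  have DxX : D x \in X (p + 2) (p + q + 1).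
    have -> : p + 2 = p + 1 + 1 by ring.
    apply: (@column_filtration_step _ q); first by lia.
      apply: (@column_filtration_step _ (q + 1)); first by lia.
        exact: total_diff_filtration.
      rewrite (@total_diffE (p - 1) _ q) ?addrK // /x !entryE.
      rewrite !(@single_out _ _ _ (p - 1)); try lia.
      rewrite (@single_out (p + 1) _ _ p); last by lia.
      by rewrite singleE !(scaler0, subr0, linear0, add0r) d2c scaler0.
    rewrite (@total_diffE p _ (q - 1)) ?addrK // /x !entryE !singleE.
    rewrite (@single_out (p + 1) _ _ p); last by lia.
    rewrite (@single_out p _ _ (p + 1)); last by lia.
    rewrite scaler0 subr0 add0r linearN linearZ_LR scalerN.
    by rewrite column_signK wc subrr.
  have [u xu] := (presents_dom hP x).2 (conj xX DxX).
  exists u, x, y; split=> //; rewrite /x !entryE singleE single_out; last by lia.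
  by rewrite scaler0 subr0.
- move=> h [x [y [/(presents_ker hP)[[xX _] [x1 [z [x1X zX xE]]]] xy yh]]].
  apply: (presents_fun hH yh); apply/(presents_ker hH).
  have DzX : D z \in X p (p + q).
    rewrite (_ : D z = x - x1); last by rewrite xE addrC addKr.
    by apply: rpredB => //; apply: column_filtration_dec x1X; lia.
  move: zX DzX x1X => /column_filtrationE zX /column_filtrationE DzX.
  move=> /column_filtrationE x1X.
  have d2z : d2 (p - 1) q (q + 1) (z (p - 1) q) = 0.
    have := DzX (p - 1) (q + 1); rewrite (@total_diffE (p - 1 - 1) _ q) ?addrK //.
    rewrite (zX (p - 1 - 1)) ?linear0 ?add0r; last by lia.
    move=> /(_ _)/(congr1 (fun c => column_sign (p - 1) *: c)).
    by rewrite column_signK scaler0; apply; lia.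
  have [v zv] := (presents_dom (hR _ _) _).2 d2z; exists v.
  apply: (presents_fun (hR _ _)) xy.
  rewrite xE entryE x1X ?add0r; last by lia.
  rewrite (total_diffE _ erefl erefl) -[e _ _ _ _]addr0.
  apply: (linear_relD (presents_linear (hR _ _))); first exact: eR.
  by apply/(presents_ker (hR _ _)); rewrite -linearZ_LR; eexists.
- move=> u [x [y [xu xy /(presents_ker hH)[v vy]]]].
  apply: (presents_fun hP xu); apply/(presents_ker hP).
  have [xX DxX] := page_class_cycle xu; split=> //.
  have [c cv] := presents_onto (hR (p - 1) q) v.
  have d2c : d2 (p - 1) q (q + 1) c = 0 by apply/(presents_dom (hR _ _)); exists v.
  have := eR p cv; rewrite vy => cy.
  have := linear_relB (presents_linear (hR _ _)) xy cy.
  rewrite subrr => /(presents_ker (hR _ _))[w wE].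
  pose z := single c + column_sign p *: single w.
  have zX : z \in X (p - 1) (p + q - 1).
    by apply: rpredD; [|apply: rpredZ]; apply: single_supported; lia.
  exists (x - D z), z; split; last by rewrite subrK.
    have DzX := total_diff_filtration zX; rewrite subrK in DzX.
    have -> : p + 1 = p - 1 + 1 + 1 by ring.
    apply: (@column_filtration_step _ q); first by lia.
      apply: (@column_filtration_step _ (q + 1)); first by lia.
        by apply: rpredB => //; apply: column_filtration_dec xX; lia.
      move/column_filtrationE: xX => xX.
      rewrite entryE xX ?add0r ?entryE; last by lia.
      rewrite (@total_diffE (p - 1 - 1) _ q) ?addrK // /z !entryE.
      rewrite !(@single_out _ _ _ (p - 1 - 1)); try lia.
      rewrite (@single_out p _ _ (p - 1)); last by lia.
      by rewrite singleE !(scaler0, addr0, linear0, add0r) d2c scaler0 oppr0.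
    rewrite subrK !entryE (total_diffE _ erefl erefl) /z !entryE !singleE.
    rewrite (@single_out p _ _ (p - 1)); last by lia.
    rewrite (@single_out (p - 1) _ _ p); last by lia.
    rewrite scaler0 addr0 add0r linearZ_LR column_signK wE.
    by apply/eqP; rewrite subr_eq0; apply/eqP; rewrite [RHS]addrC subrK.
  by have -> : p - 2%:Z + 1 = p - 1 by ring.
Qed.

End SecondPage.

(** From here on the rows are exact outside column n, and N q is the cohomology
    of row q in column n. *)
Section Abutment.
Variable n : int.
Hypothesis exact_row : forall p q c, p != n -> d1 q p (p + 1) c = 0 ->
  exists v, d1 q (p - 1) p v = c.
Variables (N : int -> lmodType A) (R : forall q, C n q -> N q -> Prop).
Variable e : forall q q', {linear N q -> N q'}.
Hypothesis hR : forall q, presents (fun c => d1 q n (n + 1) c = 0)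
  (fun c => exists v, d1 q (n - 1) n v = c) (@R q).
Hypothesis eR : forall q q' c h, R c h -> R (d2 n q q' c) (e q q' h).

Lemma column_filtration0E m x :
  (forall i j, i + j != m -> x i j = 0) -> x \in X 0 m.
Proof.
move=> hx; apply/column_filtrationE => i j /orP[i0|]; last exact: hx.
by apply: C_bound; rewrite i0.
Qed.

Lemma column_filtration_out p m x i j : x \in X p m -> i + j != m -> x i j = 0.
Proof. by move=> /column_filtrationE hx h; apply: hx; rewrite h orbT. Qed.

Lemma single_in0 p q c m : p + q = m -> @single p q c \in X 0 m.
Proof.
move=> <-; apply: column_filtration0E => i j h.
by apply: single_out; move: h; lia.
Qed.

Lemma total_diff_in0 m w : w \in X 0 (m - 1) -> D w \in X 0 m.
Proof. by move=> /total_diff_filtration; rewrite subrK. Qed.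

(** If x has nothing to the right of column t and D x nothing to the right of
    column t - k, then the rightmost entry of x is d1-closed, hence
    d1-exact, and subtracting a coboundary D s with s in column t - 1 removes it;
    this is repeated for k columns, as long as column n is not met. *)
Lemma clear_columns (k : nat) (t m : int) x : x \in X 0 m ->
  (forall i j, t < i -> x i j = 0) ->
  (forall i j, t - k%:Z < i -> D x i j = 0) ->
  (forall i, t - k%:Z < i <= t -> i != n) ->
  exists2 w, w \in X 0 (m - 1) /\ (forall i j, t <= i -> w i j = 0)
    & forall i j, t - k%:Z < i -> (x - D w) i j = 0.
Proof.
elim: k t x => [|k IH] t x xX xt Dxt tn.
  exists 0; first by rewrite rpred0.
  by move=> i j; rewrite linear0 subr0 subr0; exact: xt.
have dx : d1 (m - t) t (t + 1) (x t (m - t)) = 0.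
  have := Dxt (t + 1) (m - t); rewrite (@total_diffE t _ (m - t - 1)) ?addrK //.
  by rewrite (xt (t + 1)) ?linear0 ?scaler0 ?addr0 ?ltrDl //; apply; lia.
have [|v vE] := exact_row _ dx; first by apply: tn; lia.
pose s := single v.
have sX : s \in X 0 (m - 1) by apply: single_in0; lia.
have x1t i j : t - 1 < i -> (x - D s) i j = 0.
  move=> ti; have [ij|ij] := eqVneq (i + j) m; last first.
    apply: (@column_filtration_out 0 m) => //.
    by apply: rpredB => //; exact: total_diff_in0.
  rewrite !entryE (total_diffE _ erefl erefl).
  rewrite [s i _]single_out ?linear0 ?scaler0 ?addr0; last by lia.
  have [it|it] := eqVneq i t; last first.
    rewrite [s _ _]single_out ?linear0 ?addr0 ?subr0; last by lia.
    by apply: xt; lia.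
  have jE : j = m - t by lia.
  by rewrite it jE /s singleE vE subrr.
have tk : t - 1 - k%:Z = t - k.+1%:Z by lia.
have [|||w [wX wt] ww] := IH (t - 1) (x - D s) _ x1t.
- by apply: rpredB => //; exact: total_diff_in0.
- by rewrite linearB total_diffK subr0 tk.
- by move=> i; rewrite tk => h; apply: tn; lia.
exists (s + w); last first.
  by move=> i j; rewrite (linearD D) opprD addrA; move: ww; rewrite tk; apply.
split; first exact: rpredD.
move=> i j ti; rewrite entryE wt ?addr0; last by lia.
by apply: single_out; lia.
Qed.

Lemma clear_above m x : x \in X 0 m -> (forall i j, n < i -> D x i j = 0) ->
  exists2 w, w \in X 0 (m - 1) & forall i j, n < i -> (x - D w) i j = 0.
Proof.
move=> xX Dxn; pose k := `|Num.max b n - n|%N.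
(* The maximum makes the number k of columns to clear a natural number, also
   when column n lies to the right of all columns. *)
have kE : Num.max b n - k%:Z = n.
  by rewrite /k gez0_abs ?subr_ge0 ?le_max ?lexx ?orbT // subKr.
have [|||w [wX _]] := @clear_columns k (Num.max b n) m x xX.
- by move=> i j; rewrite gt_max => /andP[bi _]; apply: C_bound; rewrite bi orbT.
- by rewrite kE.
- by rewrite kE => i /andP[ni _]; rewrite gt_eqF.
- by rewrite kE => ww; exists w.
Qed.

Lemma clear_below m x : x \in X 0 m -> (forall i j, n <= i -> x i j = 0) ->
  D x = 0 ->
  exists2 w, w \in X 0 (m - 1) /\ (forall i j, n - 1 <= i -> w i j = 0) & x = D w.
Proof.
move=> xX xn Dx.
have [k kn] : exists k : nat, n - 1 - k%:Z < 0 by exists `|n|%N; lia.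
have [|||w hw ww] := @clear_columns k (n - 1) m x xX.
- by move=> i j h; apply: xn; lia.
- by rewrite Dx.
- by move=> i; lia.
exists w => //; apply/eqP; rewrite -subr_eq0; apply/eqP/bigraded_ext => i j.
have [i0|i0] := ltP i 0; first by apply: C_bound; rewrite i0.
by apply: ww; lia.
Qed.

(** The class attached to a cocycle x: make x vanish to the right of column n by
    subtracting a coboundary, and take the class in N of its entry in
    column n, which is then d1-closed. *)
Definition abutment_rel m (x : bigraded)
    (h : homology (e (m - n - 1) (m - n)) (e (m - n) (m - n + 1))) : Prop :=
  exists w y, [/\ x \in X 0 m, D x = 0, w \in X 0 (m - 1),
    (forall i j, n < i -> (x - D w) i j = 0)
    & R ((x - D w) n (m - n)) y /\ class_rel y h].

(** Onto: a class c in column n with e[c] = 0 has d2 c = d1 v, and the correction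
    by v in column n - 1 leaves an error D x1 to the left of column n, which is
    a coboundary by exactness there.  Kernel: if the entry in column n is
    d2 c + d1 v, subtracting D of the corresponding two-column family leaves
    only columns left of n, and again exactness applies.  Well defined: if - D w
    vanishes right of column n, then - w can be changed into w2 with the same
    property and D w2 = - D w, whose entry in column n represents some u in N
    with y = +- e u. *)
Lemma abutment_presents m :
  presents (fun x => x \in X 0 m /\ D x = 0)
    (fun x => exists2 w, w \in X 0 (m - 1) & x = D w) (@abutment_rel m).
Proof.
have ee k : e (m - n) (m - n + 1) (e (m - n - 1) (m - n) k) = 0.
  have [c ck] := presents_onto (hR _) k.
  have := eR (m - n + 1) (eR (m - n) ck).
  by rewrite d2d2; exact: (presents_fun0 (hR _)).
have hH := homology_presents ee.
split.
- move=> a x1 h1 x2 h2 [w1 [y1 [a1 b1 c1 d1' [e1 f1]]]].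
  move=> [w2 [y2 [a2 b2 c2 d2' [e2 f2]]]].
  exists (a *: w1 + w2), (a *: y1 + y2).
  have xE : a *: x1 + x2 - D (a *: w1 + w2) = a *: (x1 - D w1) + (x2 - D w2).
    by rewrite linearP scalerBr opprD addrACA.
  split.
  + by apply: rpredD => //; apply: rpredZ.
  + by rewrite linearP b1 b2 scaler0 addr0.
  + by apply: rpredD => //; apply: rpredZ.
  + by move=> i j ni; rewrite xE entryD entryZ (d1' _ _ ni) (d2' _ _ ni) scaler0 addr0.
  + rewrite xE; split; last exact: (presents_linear hH).
    exact: (presents_linear (hR _)).
- move=> x; split=> [[h [w [y [xX Dx _ _ _]]]] // | [xX Dx]].
  have [|w wX ww] := clear_above xX; first by rewrite Dx.
  have Dxw : D (x - D w) = 0 by rewrite linearB Dx total_diffK subr0.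
  have dx : d1 (m - n) n (n + 1) ((x - D w) n (m - n)) = 0.
    have := congr1 (fun z : bigraded => z (n + 1) (m - n)) Dxw.
    rewrite /= (@total_diffE n _ (m - n - 1)) ?addrK //.
    by rewrite (ww (n + 1)) ?linear0 ?scaler0 ?addr0 // ltrDl.
  have [y xy] := (presents_dom (hR _) _).2 dx.
  have [h yh] : exists h, class_rel (Z := ker (e (m - n) (m - n + 1)))
      (B := im (e (m - n - 1) (m - n))) y h.
    apply/(presents_dom hH); apply: (presents_fun (hR _) (eR (m - n + 1) xy)).
    apply/(presents_ker (hR _)).
    have := congr1 (fun z : bigraded => z n (m - n + 1)) Dxw.
    rewrite /= (@total_diffE (n - 1) _ (m - n)) ?addrK //.
    move=> /(congr1 (fun c => column_sign n *: c)).
    rewrite scalerDr column_signK scaler0 => /eqP.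
    rewrite addr_eq0 eq_sym eqr_oppLR -linearZ_LR => /eqP->.
    by eexists; exact: linearN.
  by exists h, w, y.
- move=> h; have [y yh] := presents_onto hH h.
  have ey : e (m - n) (m - n + 1) y = 0 by apply/(presents_dom hH); exists h.
  have [c cy] := presents_onto (hR (m - n)) y.
  have d1c : d1 (m - n) n (n + 1) c = 0 by apply/(presents_dom (hR _)); exists y.
  have := eR (m - n + 1) cy; rewrite ey => /(presents_ker (hR _))[v vE].
  pose x1 := single c - column_sign n *: single v.
  have x1X : x1 \in X 0 m.
    by apply: rpredB; [|apply: rpredZ]; apply: single_in0; lia.
  have Dx1X := total_diff_filtration x1X.
  have Dx1n i j : n <= i -> D x1 i j = 0.
    move=> ni; have [ij|] := eqVneq (i + j) (m + 1); last first.
      exact: (column_filtration_out Dx1X).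
    have [i0|i0] := eqVneq i n.
      have {j ij} -> : j = m - n + 1 by lia.
      rewrite i0 (@total_diffE (n - 1) _ (m - n)) ?addrK // /x1 !entryE !singleE.
      rewrite (@single_out n _ _ (n - 1)); last by lia.
      rewrite (@single_out (n - 1) _ _ n); last by lia.
      by rewrite scaler0 add0r subr0 linearN linearZ_LR vE addNr.
    have [i1|i1] := eqVneq i (n + 1).
      have {j ij} -> : j = m - n by lia.
      rewrite i1 (@total_diffE n _ (m - n - 1)) ?addrK // /x1 !entryE !singleE.
      rewrite !(@single_out _ _ _ (n + 1)); try lia.
      rewrite (@single_out (n - 1) _ _ n); last by lia.
      by rewrite !(scaler0, subr0, linear0, addr0) d1c.
    rewrite (total_diffE _ erefl erefl) /x1 !entryE.
    rewrite !(@single_out _ _ _ (i - 1)); try lia.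
    rewrite !(@single_out _ _ _ i); try lia.
    by rewrite !(scaler0, subr0, linear0, addr0).
  have [w [wX wn] wE] := clear_below Dx1X Dx1n (total_diffK x1).
  rewrite addrK in wX.
  exists (x1 - w), 0, y; rewrite linear0 subr0; split.
  + exact: rpredB.
  + by rewrite linearB wE subrr.
  + exact: rpred0.
  + move=> i j ni; rewrite /x1 !entryE wn; last by lia.
    by rewrite !single_out ?scaler0 ?subr0 //; lia.
  + split=> //; rewrite /x1 !entryE singleE wn; last by lia.
    rewrite single_out; last by lia.
    by rewrite scaler0 !subr0.
- move=> x; split.
    move=> [w [y [xX Dx wX xn [xy /(presents_ker hH)[u uE]]]]].
    have [c cu] := presents_onto (hR (m - n - 1)) u.
    have d1c : d1 (m - n - 1) n (n + 1) c = 0.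
      by apply/(presents_dom (hR _)); exists u.
    have := eR (m - n) cu; rewrite uE => cy.
    have := linear_relB (presents_linear (hR _)) xy cy.
    rewrite subrr => /(presents_ker (hR _))[v vE].
    pose z := column_sign n *: single c + single v.
    have zX : z \in X 0 (m - 1).
      by apply: rpredD; [apply: rpredZ|]; apply: single_in0; lia.
    pose x1 := x - D w - D z.
    have x1X : x1 \in X 0 m.
      by apply: rpredB; [apply: rpredB => //|]; exact: total_diff_in0.
    have x1n i j : n <= i -> x1 i j = 0.
      move=> ni; have [ij|] := eqVneq (i + j) m; last first.
        exact: (column_filtration_out x1X).
      rewrite /x1 entryD entryN.
      have [i0|i0] := eqVneq i n.
        have {j ij} -> : j = m - n by lia.
        rewrite i0 (@total_diffE (n - 1) _ (m - n - 1)) // /z !entryE !singleE.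
        rewrite (@single_out n _ _ (n - 1)); last by lia.
        rewrite (@single_out (n - 1) _ _ n); last by lia.
        rewrite scaler0 add0r addr0 linearZ_LR column_signK vE.
        by apply/eqP; rewrite subr_eq0 subrK.
      rewrite xn ?add0r; last by lia.
      apply/eqP; rewrite oppr_eq0; apply/eqP.
      have [i1|i1] := eqVneq i (n + 1).
        have {j ij} -> : j = m - n - 1 by lia.
        rewrite i1 (@total_diffE n _ (m - n - 1 - 1)) ?addrK // /z !entryE !singleE.
        rewrite !(@single_out _ _ _ (n + 1)); try lia.
        rewrite (@single_out (n - 1) _ _ n); last by lia.
        by rewrite !(scaler0, addr0, linear0) linearZ_LR d1c scaler0.
      rewrite (total_diffE _ erefl erefl) /z !entryE.
      rewrite !(@single_out _ _ _ (i - 1)); try lia.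
      rewrite !(@single_out _ _ _ i); try lia.
      by rewrite !(scaler0, addr0, linear0).
    have [|w' [w'X _] w'E] := clear_below x1X x1n.
      by rewrite /x1 !linearB !total_diffK Dx !subr0.
    exists (w + z + w'); first by apply: rpredD => //; exact: rpredD.
    have x1E : x1 = x - (D w + D z) by rewrite opprD addrA.
    by rewrite linearD [D (w + z)]linearD -w'E x1E addrC subrK.
  move=> [w wX ->]; exists w, 0; split.
  + exact: total_diff_in0.
  + exact: total_diffK.
  + exact: wX.
  + by rewrite subrr.
  + by rewrite subrr; split; [exact: presents00 (hR _)|exact: presents00 hH].
- move=> h [w [y [_ _ wX wn [xy yh]]]]; rewrite sub0r in wn xy.
  have [||w1 w1X w1n] := @clear_above (m - 1) (- w); first by rewrite rpredN.
    by rewrite linearN.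
  set w2 := - w - D w1 in w1n.
  have w2E : - D w = D w2 by rewrite /w2 linearB linearN total_diffK subr0.
  rewrite w2E in wn xy.
  have dw : d1 (m - n - 1) n (n + 1) (w2 n (m - n - 1)) = 0.
    have := wn (n + 1) (m - n - 1).
    rewrite (@total_diffE n _ (m - n - 1 - 1)) ?addrK //.
    by rewrite (w1n (n + 1)) ?linear0 ?scaler0 ?addr0 ?ltrDl //; apply.
  have [u wu] := (presents_dom (hR _) _).2 dw.
  apply: (presents_fun hH yh); apply/(presents_ker hH).
  exists (column_sign n *: u); apply: (presents_fun (hR _)) xy.
  rewrite linearZ_LR (total_diffE _ erefl erefl) -[_ *: e _ _ _]add0r.
  apply: (linear_relD (presents_linear (hR _))).
    by apply/(presents_ker (hR _)); eexists.
  by apply: (linear_relZ (presents_linear (hR _))); exact: eR.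
Qed.

Lemma double_complex_converges : converges_to double_complex_ss
  (fun m => homology (e (m - n - 1) (m - n)) (e (m - n) (m - n + 1))).
Proof.
apply: (filtered_converges total_diffK column_filtration_dec
  column_filtration_low column_filtration_high) => m.
exact: abutment_presents.
Qed.

End Abutment.
End DoubleComplex.

(** * Localization is exact *)

Section LocalizedRelation.
Variables (A : comPzRingType) (f : A).

Lemma loc_frac_eq0 (M : lmodType A) (m : M) k :
  loc_frac f m k = 0 <-> exists l, f ^+ l *: m = 0.
Proof.
split=> [/loc_frac_eq[l]|[l ml]].
  by rewrite scaler0 addn0 => ml; exists l.
by apply/loc_frac_eq; exists l; rewrite scaler0 addn0.
Qed.

(** The localization at f of R, seen as a submodule of M x Q. *)
Definition localized (M Q : lmodType A) (R : M -> Q -> Prop)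
    (x : loc M f) (y : loc Q f) : Prop :=
  exists m h k, [/\ R m h, x = loc_frac f m k & y = loc_frac f h k].

Definition loc_fmap (M N : lmodType A) (phi : {linear M -> N}) (x : loc M f) :
  loc N f := loc_frac f (phi (loc_num x)) (loc_exp x).

Lemma loc_fmapE (M N : lmodType A) (phi : {linear M -> N}) m k :
  loc_fmap phi (loc_frac f m k) = loc_frac f (phi m) k.
Proof.
rewrite /loc_fmap; have /loc_frac_eq[l e] := loc_numK (loc_frac f m k).
by apply/loc_frac_eq; exists l; rewrite -!linearZ_LR e.
Qed.

Fact loc_fmap_linear (M N : lmodType A) (phi : {linear M -> N}) :
  linear (loc_fmap phi).
Proof.
move=> a x y; have [k [m [m' [_ [-> -> _]]]]] := loc_common x y y.
by rewrite -loc_fracZ -loc_fracD !loc_fmapE linearP loc_fracD loc_fracZ.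
Qed.

HB.instance Definition _ M N phi := GRing.isLinear.Build A (loc M f) (loc N f)
  *:%R (@loc_fmap M N phi) (@loc_fmap_linear M N phi).

Section Presentation.
Variables (M Q : lmodType A) (R : M -> Q -> Prop).
Hypothesis Rlin : linear_rel R.

Lemma localized_linear : linear_rel (localized R).
Proof.
move=> a x y x' y' [m [h [k [mh -> ->]]]] [m' [h' [k' [mh' -> ->]]]].
exists (a *: (f ^+ k' *: m) + f ^+ k *: m'), (a *: (f ^+ k' *: h) + f ^+ k *: h').
exists (k + k')%N; split.
- apply: Rlin; first exact: linear_relZ.
  exact: linear_relZ.
- rewrite loc_fracD loc_fracZ (loc_frac_expand f k' m k).
  by rewrite (loc_frac_expand f k m' k') [(k' + k)%N]addnC.
- rewrite loc_fracD loc_fracZ (loc_frac_expand f k' h k).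
  by rewrite (loc_frac_expand f k h' k') [(k' + k)%N]addnC.
Qed.

End Presentation.

(** Exactness of localization: an equation between fractions holds after
    multiplying the numerators by a power of f, and R is stable under scalars. *)
Lemma localized_presents (L M N Q : lmodType A)
    (i : {linear L -> M}) (g : {linear M -> N}) (R : M -> Q -> Prop) :
  presents (fun m => g m = 0) (fun m => exists w, i w = m) R ->
  presents (fun x => loc_fmap g x = 0) (fun x => exists w, loc_fmap i w = x)
    (localized R).
Proof.
move=> hR; have Rlin := presents_linear hR; split.
- exact: localized_linear.
- move=> x; split=> [[y [m [h [k [mh -> _]]]]]|].
    rewrite loc_fmapE; have -> : g m = 0 by apply/(presents_dom hR); exists h.
    exact: loc_zeroE.
  have [m [k ->]] := loc_fracP x; rewrite loc_fmapE => /loc_frac_eq0[l].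
  rewrite -linearZ_LR => /(presents_dom hR)[h mh].
  exists (loc_frac f h (k + l)), (f ^+ l *: m), h, (k + l)%N; split=> //.
  exact: loc_frac_expand.
- move=> y; have [h [k ->]] := loc_fracP y.
  have [m mh] := presents_onto hR h.
  by exists (loc_frac f m k), m, h, k.
- move=> x; split=> [[m [h [k [mh -> /esym/loc_frac_eq0[l hl]]]]]|[w <-]].
    have := linear_relZ Rlin (f ^+ l) mh; rewrite hl => /(presents_ker hR)[w wE].
    by exists (loc_frac f w (k + l)); rewrite loc_fmapE wE -loc_frac_expand.
  have [u [k ->]] := loc_fracP w; exists (i u), 0, k; split.
  + by apply/(presents_ker hR); exists u.
  + exact: loc_fmapE.
  + by rewrite loc_zeroE.
- move=> y [m [h [k [mh /esym/loc_frac_eq0[l ml] ->]]]].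
  apply/loc_frac_eq0; exists l; apply: (presents_fun0 hR).
  by rewrite -ml; exact: linear_relZ.
Qed.

End LocalizedRelation.

Lemma localized_loc_map (A : comPzRingType) (M Q : lmodType A) (R : M -> Q -> Prop)
    (b f f' : A) (x : loc M f) (y : loc Q f) :
  linear_rel R -> f' = b * f -> localized R x y ->
  localized R (loc_map b f' x) (loc_map b f' y).
Proof.
move=> Rlin e [m [h [k [mh -> ->]]]]; exists (b ^+ k *: m), (b ^+ k *: h), k.
by split; [exact: linear_relZ|exact: loc_mapE|exact: loc_mapE].
Qed.

Lemma prodmod_presents (A : comPzRingType) (T : Type) (F G : T -> lmodType A)
    (Z B : forall t, F t -> Prop) (R : forall t, F t -> G t -> Prop) :
  (forall t, presents (@Z t) (@B t) (@R t)) ->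
  presents (fun x : prodmod F => forall t, Z t (x t))
    (fun x : prodmod F => forall t, B t (x t))
    (fun (x : prodmod F) (y : prodmod G) => forall t, R t (x t) (y t)).
Proof.
move=> hR; split.
- by move=> a x y x' y' h h' t; exact: (presents_linear (hR t)).
- move=> x; split=> [[y xy] t|xZ].
    by apply/(presents_dom (hR t)); exists (y t).
  pose y t := cid ((presents_dom (hR t) (x t)).2 (xZ t)).
  by exists (fun t => projT1 (y t)) => t; exact: projT2 (y t).
- move=> y; pose x t := cid (presents_onto (hR t) (y t)).
  by exists (fun t => projT1 (x t)) => t; exact: projT2 (x t).
- by move=> x; split=> h t; apply/(presents_ker (hR t)); exact: h.
- move=> y h; apply: functional_extensionality_dep => t.
  exact: (presents_fun0 (hR t)).
Qed.

(** * Functoriality of the Cech complex *)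

Section CechFunctor.
Variables (A : comPzRingType) (r : nat) (a : 'I_r -> A).

Local Notation cech N p := (cech_obj a N p).

Section Relation.
Variables (M Q : lmodType A) (R : M -> Q -> Prop).
Hypotheses (Rlin : linear_rel R) (R0 : R 0 0).

Definition cech_rel p (x : cech M p) (y : cech Q p) : Prop :=
  forall S, localized R (x S) (y S).

(** The Cech differential is a combination of the canonical maps between
    localizations, each of which preserves the localized relation; so it
    preserves any relation between coefficients, in particular the graph of a
    linear map. *)
Lemma cech_rel_diff p p' (x : cech M p) (y : cech Q p) : cech_rel x y ->
  cech_rel (cech_diff (p' := p') x) (cech_diff (p' := p') y).
Proof.
move=> xy S; rewrite /cech_diff.
have loc0 g : localized R (0 : loc M g) (0 : loc Q g) by exists 0, 0, 0%N.
apply: (linear_rel_sum (localized_linear Rlin)) => // i iS.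
apply: (linear_relZ (localized_linear Rlin)).
apply: (localized_loc_map Rlin (cech_denD1 a iS)).
by rewrite /cech_comp; case: eqP => [h|_]; [exact: (xy (cech_face h))|exact: loc0].
Qed.

End Relation.

Lemma cech_presents (L M N Q : lmodType A) (i : {linear L -> M})
    (g : {linear M -> N}) (R : M -> Q -> Prop) p :
  presents (fun m => g m = 0) (fun m => exists w, i w = m) R ->
  presents (fun x : cech M p => forall S, loc_fmap g (x S) = 0)
    (fun x : cech M p => forall S, exists w, loc_fmap i w = x S)
    (@cech_rel _ _ R p).
Proof.
move=> hR.
exact: (prodmod_presents
  (fun S : cech_index r p => localized_presents (cech_den a (val S)) hR)).
Qed.

Definition cech_map_fun (M N : lmodType A) (phi : {linear M -> N}) p
  (x : cech M p) : cech N p := fun S => loc_fmap phi (x S).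

Fact cech_map_linear (M N : lmodType A) (phi : {linear M -> N}) p :
  linear (@cech_map_fun M N phi p).
Proof.
move=> c x y; apply: functional_extensionality_dep => S.
by rewrite /cech_map_fun !prodmod_addE !prodmod_scaleE linearP.
Qed.

HB.instance Definition _ M N phi p := GRing.isLinear.Build A (cech M p) (cech N p)
  *:%R (@cech_map_fun M N phi p) (@cech_map_linear M N phi p).

Definition cech_map (M N : lmodType A) (phi : {linear M -> N}) p :
  {linear cech M p -> cech N p} := @cech_map_fun M N phi p.

Lemma cech_mapE (M N : lmodType A) (phi : {linear M -> N}) p (x : cech M p) S :
  cech_map phi p x S = loc_fmap phi (x S).
Proof. by []. Qed.

Lemma cech_map_graph (M N : lmodType A) (phi : {linear M -> N}) p
    (x : cech M p) (y : cech N p) :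
  cech_rel (fun m n => n = phi m) x y <-> y = cech_map phi p x.
Proof.
split=> [xy|-> S].
  apply: functional_extensionality_dep => S.
  by have [m [h [k [-> xE ->]]]] := xy S; rewrite cech_mapE xE loc_fmapE.
have [m [k xE]] := loc_fracP (x S); exists m, (phi m), k; split=> //.
by rewrite cech_mapE xE loc_fmapE.
Qed.

Lemma cech_map_diff (M N : lmodType A) (phi : {linear M -> N}) p p' (x : cech M p) :
  cech_diff (p' := p') (cech_map phi p x) = cech_map phi p' (cech_diff (p' := p') x).
Proof.
apply/cech_map_graph/cech_rel_diff; last exact/cech_map_graph.
  by move=> c m n m' n' -> ->; rewrite linearP.
by rewrite linear0.
Qed.

Lemma cech_map_linear_comb (M N : lmodType A) (phi phi1 phi2 : {linear M -> N}) c p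
    (x : cech M p) :
  (forall m, phi m = c *: phi1 m + phi2 m) ->
  cech_map phi p x = c *: cech_map phi1 p x + cech_map phi2 p x.
Proof.
move=> h; apply: functional_extensionality_dep => S.
rewrite prodmod_addE prodmod_scaleE !cech_mapE.
have [m [k ->]] := loc_fracP (x S); rewrite !loc_fmapE h.
by rewrite loc_fracD loc_fracZ.
Qed.

Lemma cech_map_comp (M N P : lmodType A) (phi : {linear M -> N})
    (psi : {linear N -> P}) (chi : {linear M -> P}) c p (x : cech M p) :
  (forall m, psi (phi m) = c *: chi m) ->
  cech_map psi p (cech_map phi p x) = c *: cech_map chi p x.
Proof.
move=> h; apply: functional_extensionality_dep => S.
rewrite prodmod_scaleE !cech_mapE.
have [m [k ->]] := loc_fracP (x S); rewrite !loc_fmapE h.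
by rewrite loc_fracZ.
Qed.

Lemma cech_map_scale (M : lmodType A) (phi : {linear M -> M}) c p (x : cech M p) :
  (forall m, phi m = c *: m) -> cech_map phi p x = c *: x.
Proof.
move=> h; apply: functional_extensionality_dep => S.
rewrite prodmod_scaleE cech_mapE.
have [m [k ->]] := loc_fracP (x S); rewrite loc_fmapE h.
by rewrite loc_fracZ.
Qed.

Lemma cech_homology_presents (L M N Q : lmodType A) (i : {linear L -> M})
    (g : {linear M -> N}) (R : M -> Q -> Prop) p :
  presents (fun m => g m = 0) (fun m => exists w, i w = m) R ->
  presents (fun x => cech_map g p x = 0) (fun x => exists w, cech_map i p w = x)
    (@cech_rel _ _ R p).
Proof.
move=> hR; apply: (presents_eqv (cech_presents p hR)) => x.
  split=> [h|h S]; first exact: functional_extensionality_dep.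
  by rewrite -cech_mapE h.
split=> [h|[w <-] S]; last by exists (w S).
exists (fun S => projT1 (cid (h S))).
by apply: functional_extensionality_dep => S; exact: projT2 (cid (h S)).
Qed.

Lemma cech_obj_bound (N : lmodType A) (p : int) :
  (p < 0) || (r%:Z < p) -> is_zero (cech N p).
Proof.
move=> pr x; apply: functional_extensionality_dep => -[S /= SE]; exfalso.
have Sr : (#|S| <= r)%N by rewrite -[r in (_ <= r)%N]card_ord max_card.
by move: pr; rewrite -(eqP SE) !ltz_nat ltn0 ltnNge Sr.
Qed.

End CechFunctor.

(** * Exactness of Hom from a projective module *)

Section ProjectiveLift.
Variables (A : comPzRingType) (P : lmodType A).
Hypothesis P_proj : projective P.

(** Projectivity for relations: the projection from the submodule R of M x Q to
    its range in Q is onto, and eta lifts along it.  Taking for R the inverse of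
    the graph of a map gives lifts along that map; taking a presentation
    lifts maps into a subquotient. *)
Lemma projective_lift (M Q : lmodType A) (R : M -> Q -> Prop)
    (eta : {linear P -> Q}) :
  linear_rel R -> (forall x, exists m, R m (eta x)) ->
  exists phi : {linear P -> M}, forall x, R (phi x) (eta x).
Proof.
move=> Rlin etaR.
have R00 : R 0 0 by have [m] := etaR 0; exact: linear_rel00.
have RD c (u v : (M * Q)%type) : R u.1 u.2 -> R v.1 v.2 ->
    R (c *: u + v).1 (c *: u + v).2 by exact: Rlin.
pose G := @submodule_of A (M * Q)%type (fun u => R u.1 u.2) R00 RD.
have I0 : exists m, R m 0 by exists 0.
have ID c (x y : Q) : (exists m, R m x) -> (exists m, R m y) ->
    exists m, R m (c *: x + y).
  by move=> [m mx] [m' my]; exists (c *: m + m'); exact: Rlin.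
pose I := submodule_of I0 ID.
have [g gE] : exists g : {linear submod G -> submod I},
    forall u v, (val u).2 = val v <-> v = g u.
  apply: linear_rel_fun.
  - by move=> c u v u' v' e e'; rewrite !linearP /= e e'.
  - move=> u; have uI : (val u).2 \in I.
      apply/submodule_ofE.
      have uG : val u \in G := valP u.
      by exists (val u).1; move/submodule_ofE: uG.
    by have [v vE] := submod_lift uI; exists v.
  - by move=> v; rewrite linear0 => e; apply: val_inj; rewrite -e linear0.
have [f fE] : exists f : {linear P -> submod I},
    forall x v, eta x = val v <-> v = f x.
  apply: linear_rel_fun.
  - by move=> c x v x' v' e e'; rewrite !linearP /= e e'.
  - move=> x; have xI : eta x \in I by exact/submodule_ofE.
    by have [v vE] := submod_lift xI; exists v.
  - by move=> v; rewrite linear0 => e; apply: val_inj; rewrite -e linear0.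
have [|h hE] := P_proj (g := g) f.
  move=> v; have vI : val v \in I := valP v.
  have /submodule_ofE[m mv] := vI.
  have mvG : (m, val v) \in G by exact/submodule_ofE.
  have [u uE] := submod_lift mvG; exists u.
  by apply/esym/gE; rewrite uE.
have [phi phiE] : exists phi : {linear P -> M},
    forall x m, (val (h x)).1 = m <-> m = phi x.
  apply: linear_rel_fun => [c x m x' m' <- <-|x|m <-].
  - by rewrite !linearP.
  - by exists (val (h x)).1.
  - by rewrite !linear0.
exists phi => x.
have hx1 : (val (h x)).1 = phi x by exact/phiE.
have hx2 : (val (h x)).2 = eta x.
  by rewrite (_ : eta x = val (f x)); [apply/gE; rewrite hE|apply/fE].
have hG : val (h x) \in G := valP (h x).
by rewrite -hx1 -hx2; move/submodule_ofE: hG.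
Qed.

Lemma hom_presents (M Q : lmodType A) (Z B : M -> Prop) (R : M -> Q -> Prop) :
  presents Z B R ->
  presents (fun phi : Hom P M => forall x, Z (hom_fun phi x))
    (fun phi : Hom P M => forall x, B (hom_fun phi x))
    (fun (phi : Hom P M) (eta : Hom P Q) =>
       forall x, R (hom_fun phi x) (hom_fun eta x)).
Proof.
move=> hR; split.
- move=> c f1 h1 f2 h2 fh1 fh2 x.
  exact: (presents_linear hR c (fh1 x) (fh2 x)).
- move=> f; split=> [[h fh] x|fZ].
    by apply/(presents_dom hR); exists (hom_fun h x).
  have [h hE] : exists h : {linear P -> Q},
      forall x y, R (hom_fun f x) y <-> y = h x.
    apply: linear_rel_fun => [c x y x' y' h h'|x|y].
    + by rewrite /hom_fun linearP; exact: (presents_linear hR).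
    + exact/(presents_dom hR).
    + by rewrite /hom_fun linear0; exact: (presents_fun0 hR).
  by exists (h : Hom P Q) => x; exact/hE.
- move=> h; have [|f fh] := @projective_lift _ _ R h (presents_linear hR).
    by move=> x; exact: (presents_onto hR).
  by exists (f : Hom P M).
- by move=> f; split=> h x; apply/(presents_ker hR); exact: h.
- move=> h h0; apply: hom_ext => x; exact: (presents_fun0 hR (h0 x)).
Qed.

(** A lift of the identity of P along the surjection A^k -> P given by the
    generators. *)
Lemma dual_basis : finite_type P ->
  exists (k : nat) (g : 'I_k -> P) (e : 'I_k -> Hom P A^o),
    forall x, x = \sum_i hom_fun (e i) x *: g i.
Proof.
move=> [k [g gP]]; exists k, g.
pose F (_ : 'I_k) : lmodType A := A^o.
pose R (c : prodmod F) (x : P) := x = \sum_i (c i : A) *: g i.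
have [||phi phiE] := @projective_lift (prodmod F) P R idfun.
- move=> b c x c' x' -> ->; rewrite scaler_sumr -big_split; apply: eq_bigr => i _ /=.
  by rewrite prodmod_addE prodmod_scaleE scalerDl scalerA.
- by move=> x; have [c ->] := gP x; exists c.
have e_lin i : linear (fun x => phi x i : A^o) by move=> b x y; rewrite linearP.
pose e i : Hom P A^o :=
  HB.pack_for {linear P -> A^o} (fun x => phi x i : A^o)
    (GRing.isLinear.Build _ _ _ _ _ (e_lin i)).
by exists e => x; exact: phiE.
Qed.

End ProjectiveLift.

Lemma presents_pullback (A : comPzRingType) (W' W Q : lmodType A)
    (Z B : W -> Prop) (R : W -> Q -> Prop) (t : {linear W' -> W}) :
  bijective t -> presents Z B R ->
  presents (fun x => Z (t x)) (fun x => B (t x)) (fun x y => R (t x) y).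
Proof.
move=> [s ts st] hR; split.
- by move=> c x y x' y' h h'; rewrite linearP; exact: (presents_linear hR).
- by move=> x; exact: (presents_dom hR).
- by move=> y; have [x xy] := presents_onto hR y; exists (s x); rewrite st.
- by move=> x; exact: (presents_ker hR).
- by move=> y; rewrite linear0; exact: (presents_fun0 hR).
Qed.

(** * Cech complexes of duals of projective modules of finite type *)

Section CechDual.
Variables (A : comPzRingType) (r : nat) (a : 'I_r -> A) (P : lmodType A).

Fact hom_eval_linear (N : lmodType A) x : linear (fun phi : Hom P N => hom_fun phi x).
Proof. by []. Qed.

Definition hom_eval (N : lmodType A) (x : P) : {linear Hom P N -> N} :=
  HB.pack_for {linear Hom P N -> N} (fun phi : Hom P N => hom_fun phi x)
    (GRing.isLinear.Build _ _ _ _ _ (@hom_eval_linear N x)).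

Local Notation dual := (Hom P A^o).

Fact cech_eval_linear p (c : cech_obj a dual p) :
  linear (fun x : P => cech_map a (hom_eval A^o x) p c).
Proof.
by move=> b x y; apply: cech_map_linear_comb => phi /=; rewrite /hom_fun linearP.
Qed.

Definition cech_eval_fun p (c : cech_obj a dual p) : Hom P (cech_obj a A^o p) :=
  HB.pack_for {linear P -> cech_obj a A^o p}
    (fun x : P => cech_map a (hom_eval A^o x) p c)
    (GRing.isLinear.Build _ _ _ _ _ (cech_eval_linear c)).

Fact cech_eval_fun_linear p : linear (@cech_eval_fun p).
Proof.
by move=> b c c'; apply: hom_ext => x; rewrite /hom_fun /= linearP.
Qed.

HB.instance Definition _ p := GRing.isLinear.Build A (cech_obj a dual p)
  (Hom P (cech_obj a A^o p)) *:%R (@cech_eval_fun p) (@cech_eval_fun_linear p).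

(** The natural map Cech^p(Hom(P, A)) -> Hom(P, Cech^p(A)), evaluating the
    numerators. *)
Definition cech_eval p : {linear cech_obj a dual p -> Hom P (cech_obj a A^o p)} :=
  @cech_eval_fun p.

Lemma cech_evalE p c x :
  hom_fun (cech_eval p c) x = cech_map a (hom_eval A^o x) p c.
Proof. by []. Qed.

Lemma cech_eval_diff p p' c x :
  hom_fun (cech_eval p' (cech_diff (p' := p') c)) x =
  cech_diff (p' := p') (hom_fun (cech_eval p c) x).
Proof. by rewrite !cech_evalE cech_map_diff. Qed.

Hypotheses (P_proj : projective P) (P_ft : finite_type P).

(** A fraction phi / f^j with all phi(x) / f^j = 0 is zero: one power of f kills
    the values of phi on the finitely many generators. *)
Lemma cech_eval_inj p c : cech_eval p c = 0 -> c = 0.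
Proof.
have [k [g gP]] := P_ft => c0.
apply: functional_extensionality_dep => S.
have [phi [j cE]] := loc_fracP (c S); rewrite cE; apply/loc_frac_eq0.
have phig i : exists l, cech_den a (val S) ^+ l *: hom_fun phi (g i) = 0.
  apply/(loc_frac_eq0 _ _ j).
  have := congr1 (fun h : Hom P (cech_obj a A^o p) => hom_fun h (g i) S) c0.
  by rewrite cech_evalE cech_mapE cE loc_fmapE.
(* The sum of the exponents is an exponent that serves for every generator. *)
have [l lE] := choice phig; exists (\sum_i l i)%N.
apply: hom_ext => x; have [b ->] := gP x.
rewrite {1}/hom_fun /= linear_sum scaler_sumr big1 // => i _.
rewrite linearZ_LR scalerA mulrC -scalerA (bigD1 i) //= addnC exprD -scalerA.
by rewrite (lE i) !scaler0.
Qed.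

(** With a dual basis (g i, e i) of P one has psi x = sum_i e i x *: psi (g i);
    multiplying the numerators of psi (g i) by e i gives an element of
    Cech^p(Hom(P, A)), and the sum of these elements evaluates to psi. *)
Lemma cech_eval_surj p (psi : Hom P (cech_obj a A^o p)) : exists c, cech_eval p c = psi.
Proof.
have [k [g [e ge]]] := dual_basis P_proj P_ft.
have mul_lin i : linear (fun t : A^o => (t : A) *: e i : dual).
  by move=> b s t; rewrite scalerDl scalerA.
pose mul i : {linear A^o -> dual} := HB.pack_for {linear A^o -> dual}
    (fun t : A^o => (t : A) *: e i : dual)
    (GRing.isLinear.Build _ _ _ _ _ (mul_lin i)).
exists (\sum_i cech_map a (mul i) p (hom_fun psi (g i))).
apply: hom_ext => x; rewrite cech_evalE linear_sum.
rewrite [in RHS](ge x) /hom_fun linear_sum; apply: eq_bigr => i _.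
transitivity (hom_fun (e i) x *:
    cech_map a (idfun : {linear A^o -> A^o}) p (hom_fun psi (g i))).
  by apply: cech_map_comp => t; exact: mulrC.
rewrite linearZ_LR (@cech_map_scale _ _ _ _ _ 1) ?scale1r // => t.
by rewrite scale1r.
Qed.

Lemma cech_eval_bij p : bijective (cech_eval p).
Proof.
have [s sE] := choice (@cech_eval_surj p).
exists s => // c; apply/eqP; rewrite -subr_eq0; apply/eqP/cech_eval_inj.
by rewrite linearB sE subrr.
Qed.

Lemma cech_dual_presents p (Q : lmodType A) (R : cech_obj a A^o p -> Q -> Prop) :
  presents (fun x => cech_diff (p' := p + 1) x = 0)
    (fun x => exists w : cech_obj a A^o (p - 1), cech_diff (p' := p) w = x) R ->
  presents (fun c => cech_diff (p' := p + 1) c = 0)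
    (fun c => exists w : cech_obj a dual (p - 1), cech_diff (p' := p) w = c)
    (fun c (eta : Hom P Q) => forall x, R (hom_fun (cech_eval p c) x) (hom_fun eta x)).
Proof.
move=> /(hom_presents P_proj)/(presents_pullback (cech_eval_bij p)) hR.
apply: (presents_eqv hR) => c.
  split=> [h|h x]; last by rewrite -cech_eval_diff h linear0.
  by apply: cech_eval_inj; apply: hom_ext => x; rewrite cech_eval_diff h.
split=> [h|[w <-] x]; last first.
  by exists (hom_fun (cech_eval _ w) x); rewrite cech_eval_diff.
have Rlin : linear_rel (fun w (x : cech_obj a A^o p) =>
    cech_diff (p' := p) (w : cech_obj a A^o (p - 1)) = x).
  by move=> b x y x' y' <- <-; rewrite linearP.
have [psi psiE] := projective_lift P_proj Rlin h.
have [w wE] := cech_eval_surj (psi : Hom P _).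
exists w; apply/eqP; rewrite -subr_eq0; apply/eqP/cech_eval_inj.
rewrite linearB; apply/eqP; rewrite subr_eq0; apply/eqP/hom_ext => x.
by rewrite cech_eval_diff wE; exact: psiE.
Qed.

End CechDual.

(** * The double complex Cech^p(Hom(K^-q, A)) *)

Section CechOfDualComplex.
Variables (A : comPzRingType) (r : nat) (a : 'I_r -> A) (K : cochain_complex A).
Hypotheses (K_proj : forall i, projective (K i)) (K_ft : forall i, finite_type (K i)).

Local Notation L := (hom_complex K A^o).
Local Notation C := (fun p q => cech_obj a (L q) p).
Local Notation H p := (local_cohomology a A^o p).

Definition cech_direction q p p' : {linear C p q -> C p' q} :=
  @cech_diff A r a (L q) p p'.

Definition dual_direction p q q' : {linear C p q -> C p q'} :=
  cech_map a (codiff L q q') p.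

Lemma cech_direction_comp q p p' p'' c :
  cech_direction q p' p'' (cech_direction q p p' c) = 0.
Proof. exact: cech_diff_comp. Qed.

Lemma dual_direction_comp p q q' q'' c :
  dual_direction p q' q'' (dual_direction p q q' c) = 0.
Proof.
rewrite /dual_direction -(scale0r (cech_map a (codiff L q q'') p c)).
by apply: cech_map_comp => phi; rewrite codiff_comp scale0r.
Qed.

Lemma directions_commute p p' q q' c :
  cech_direction q' p p' (dual_direction p q q' c) =
  dual_direction p' q q' (cech_direction q p p' c).
Proof. exact: cech_map_diff. Qed.

Lemma cech_bound (p q : int) : (p < 0) || (r%:Z < p) -> is_zero (C p q).
Proof. exact: cech_obj_bound. Qed.

Lemma cohomology_presents (T : cochain_complex A) i :
  presents (fun x => codiff T i (i + 1) x = 0)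
    (fun x => exists w, codiff T (i - 1) i w = x)
    (@class_rel _ _ (ker (codiff T i (i + 1))) (im (codiff T (i - 1) i))).
Proof. by apply: homology_presents => w; exact: codiff_comp. Qed.

(** The cohomology along q at (p, q) is the Cech module of H^q(Hom(K, A)). *)
Definition column_class p q : C p q -> cech_obj a (cohomology L q) p -> Prop :=
  @cech_rel _ _ a _ _ (@class_rel _ _ _ _) p.

Lemma column_class_presents p q :
  presents (fun c => dual_direction p q (q + 1) c = 0)
    (fun c => exists v, dual_direction p (q - 1) q v = c) (@column_class p q).
Proof. exact/cech_homology_presents/cohomology_presents. Qed.

Lemma column_class_diff q p p' c h : @column_class p q c h ->
  @column_class p' q (cech_direction q p p' c)
    (@cech_diff A r a (cohomology L q) p p' h).
Proof.
have hL := cohomology_presents L q.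
exact: (cech_rel_diff (presents_linear hL) (presents00 hL)).
Qed.

(** The cohomology along p at (p, q) is Hom(K^-q, H^p_I(A)). *)
Definition row_class p q (c : C p q) (eta : Hom (K (- q)) (H p)) : Prop :=
  forall x, @class_rel _ _ (ker (codiff (cech_complex a A^o) p (p + 1)))
    (im (codiff (cech_complex a A^o) (p - 1) p))
    (hom_fun (cech_eval a (K (- q)) p c) x) (hom_fun eta x).

Lemma row_class_presents p q :
  presents (fun c => cech_direction q p (p + 1) c = 0)
    (fun c => exists v, cech_direction q (p - 1) p v = c) (@row_class p q).
Proof.
apply: cech_dual_presents => //.
exact: (cohomology_presents (cech_complex a A^o)).
Qed.

Lemma row_class_diff p q q' c eta : @row_class p q c eta ->
  @row_class p q' (dual_direction p q q' c) (codiff (hom_complex K (H p)) q q' eta).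
Proof.
move=> h x; have hp := cohomology_presents (cech_complex a A^o) p.
pose s : A := (-1) ^+ `|q|.+1.
have -> : hom_fun (cech_eval a (K (- q')) p (dual_direction p q q' c)) x =
    s *: hom_fun (cech_eval a (K (- q)) p c) (codiff K (- q') (- q) x).
  by apply: cech_map_comp.
exact: (linear_relZ (presents_linear hp) s (h _)).
Qed.

Lemma row_exact n p : (forall i, i != n -> is_zero (H i)) -> p != n ->
  forall q c, cech_direction q p (p + 1) c = 0 ->
  exists v, cech_direction q (p - 1) p v = c.
Proof.
move=> H0 pn q c /(presents_dom (row_class_presents p q))[eta h].
apply/(presents_ker (row_class_presents p q)).
have <- : eta = 0 by apply: hom_ext => x; exact: (H0 p pn).
exact: h.
Qed.

End CechOfDualComplex.

Theorem proposition6p1 (A : comPzRingType) (I : submodule A^o)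
    (r : nat) (a : 'I_r -> A) (a_generates_I : generates a I)
    (n : int)
    (H_vanish : forall i : int, i != n -> is_zero (local_cohomology a A^o i))
    (K : cochain_complex A)
    (K_projective : forall i : int, projective (K i))
    (K_finite_type : forall i : int, finite_type (K i))
    (K_or_A : bounded_below K \/ (noetherian A /\ finite_dimensional A)) :
  exists E : spectral_sequence A,
    (forall p q : int,
       E 2%N p q ≃ local_cohomology a (cohomology (hom_complex K A^o) q) p) /\
    converges_to E (fun m : int =>
      cohomology (hom_complex K (local_cohomology a A^o n)) (m - n)).
Proof.
exists (double_complex_ss (@cech_direction_comp A r a K)
  (@dual_direction_comp A r a K) (@directions_commute A r a K)).
split=> [p q|].
  exact: (second_page _ _ _ (@column_class_presents A r a K)
    (@column_class_diff A r a K)).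
apply: (double_complex_converges _ _ _ (@cech_bound A r a K) _
  (fun q => @row_class_presents A r a K K_projective K_finite_type n q)
  (@row_class_diff A r a K n)) => p q c pn.
exact: (row_exact K_projective K_finite_type H_vanish pn).
Qed.
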